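(* Let $J>0$ and $h\in\mathbb{R}$ be fixed, and for each $N\ge 1$ let $D$ be a random dimer configuration sampled from the Gibbs measure $\mathbb{P}$ of the imitative monomer-dimer model on the complete graph with $N$ vertices and parameters $(J,h)$, with $\mathscr{M}(D)$ its set of monomers. (i) If $(J,h)\notin\Gamma\cup\{(J_c,h_c)\}$ and $m_0$ is the unique maximizer of $\tilde p$ on $[0,1]$, then $\lambda:=-\tilde p''(m_0)^{-1}-(2J)^{-1}>0$ and there exists a constant $K$ (independent of $N$) such that for all $N\geq 1$, $$\sup_{z\in\mathbb{R}}\Bigl|\mathbb{P}\Bigl(\frac{|\mathscr{M}(D)|-Nm_0}{N^{1/2}}\le z\Bigr)-\mathbb{P}(X\le z)\Bigr|\le \frac{K}{N^{1/2}},$$ where $X$ is a normal random variable with mean zero and variance $\lambda$. (ii) If $(J,h)=(J_c,h_c)$ and $m_0=m_c=2-\sqrt2$ is the unique maximizer of $\tilde p$ on $[0,1]$, then $\lambda_c:=-\tilde p^{(4)}(m_c)>0$ and there exists a constant $K$ (independent of $N$) such that for all $N\geq 1$, $$\sup_{z\in\mathbb{R}}\Bigl|\mathbb{P}\Bigl(\frac{|\mathscr{M}(D)|-Nm_0}{N^{3/4}}\le z\Bigr)-\mathbb{P}(Y\le z)\Bigr|\le \frac{K}{N^{1/4}},$$ where $Y$ is a random variable with density $c\,e^{-\lambda_c z^4/24}$ on $\mathbb{R}$, $c$ being the normalizing constant.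
   Context: Model. For $N\ge1$ let $V=\{1,\dots,N\}$ and let $E=\{uv\equiv\{u,v\}:u,v\in V,\ u<v\}$ be the edge set of the complete graph on $V$. A dimer configuration is a set $D\subseteq E$ of pairwise vertex-disjoint edges (possibly empty); $\mathscr{D}$ is the set of all dimer configurations. The monomer set $\mathscr{M}(D)$ is the set of vertices not covered by any edge of $D$, so $2|D|+|\mathscr{M}(D)|=N$. The monomer density is $m(D)=|\mathscr{M}(D)|/N$. With $a=J$ and $b=\frac{\log N}{2}+h-J$, the Hamiltonian is $-H(D)=N(a\,m(D)^2+b\,m(D))$ and the Gibbs measure is $\mathbb{P}(D)=e^{-H(D)}/\sum_{D'\in\mathscr{D}}e^{-H(D')}$. Variational function. Let $$g(x)=\tfrac12\bigl(\sqrt{e^{4x}+4e^{2x}}-e^{2x}\bigr),\qquad \tau(x)=(2x-1)J+h,$$ $$\tilde p(m)=-Jm^2-\tfrac12\Bigl(1-g(\tau(m))+\log\bigl(1-g(\tau(m))\bigr)\Bigr),\quad m\in[0,1].$$ Derivatives of $\tilde p$ are with respect to $m$. Phase diagram (known facts used to define the objects). Let $J_c=\frac{1}{4(3-2\sqrt2)}$ and $h_c=\frac12\log(2\sqrt2-2)-\frac14$. There is a function $\gamma:[J_c,\infty)\to\mathbb{R}$ with $\gamma(J_c)=h_c$ such that, with $\Gamma:=\{(J,\gamma(J)):J>J_c\}$: if $(J,h)\notin\Gamma$, then $\tilde p$ has a unique maximizer $m_0$ on $[0,1]$; if $(J,h)\in\Gamma$, then $\tilde p$ has exactly two distinct maximizers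 on $[0,1]$. If $(J,h)\notin\Gamma\cup\{(J_c,h_c)\}$ then $\tilde p''(m_0)<0$. If $(J,h)=(J_c,h_c)$ then $m_0=m_c:=2-\sqrt2$, $\tilde p^{(j)}(m_c)=0$ for $j=1,2,3$ and $\tilde p^{(4)}(m_c)<0$. *)

(* Defs.v *)
From HB Require Import structures.
From mathcomp Require Import all_boot all_order all_algebra.
From mathcomp Require Import all_classical all_reals all_analysis.

Set Implicit Arguments.
Unset Strict Implicit.
Unset Printing Implicit Defensive.

Import Order.TTheory GRing.Theory Num.Theory.
Import numFieldNormedType.Exports.

Local Open Scope classical_set_scope.
Local Open Scope ring_scope.

Definition edges (N : nat) : {set {set 'I_N}} :=
  [set e : {set 'I_N} | #|e| == 2]%SET.

Definition is_dimer (N : nat) (D : {set {set 'I_N}}) : bool :=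
  (D \subset edges N) && finset.trivIset D.

Definition monomers (N : nat) (D : {set {set 'I_N}}) : {set 'I_N} :=
  (~: finset.cover D)%SET.

Definition monomer_density (R : realType) (N : nat) (D : {set {set 'I_N}}) : R :=
  #|monomers D|%:R / N%:R.

(* [hamiltonian J h D] is H(D), so that the Gibbs weight is exp (- H(D)). *)
Definition hamiltonian (R : realType) (J h : R) (N : nat)
    (D : {set {set 'I_N}}) : R :=
  let a := J in
  let b := ln N%:R / 2 + h - J in
  let m := monomer_density R D in
  - (N%:R * (a * m ^+ 2 + b * m)).

Definition partition_function (R : realType) (J h : R) (N : nat) : R :=
  \sum_(D : {set {set 'I_N}} | is_dimer D) expR (- hamiltonian J h D).

Definition gibbs (R : realType) (J h : R) (N : nat)
    (A : pred {set {set 'I_N}}) : R :=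
  \sum_(D : {set {set 'I_N}} | is_dimer D && A D)
    expR (- hamiltonian J h D) / partition_function J h N.

(* The distribution function of (|M(D)| - N m) / N^r under the Gibbs measure. *)
Definition monomer_cdf (R : realType) (J h : R) (N : nat) (m r z : R) : R :=
  gibbs J h (fun D : {set {set 'I_N}} =>
    (#|monomers D|%:R - N%:R * m) / N%:R `^ r <= z).

Definition g (R : realType) (x : R) : R :=
  (Num.sqrt (expR (4 * x) + 4 * expR (2 * x)) - expR (2 * x)) / 2.

Definition tau (R : realType) (J h x : R) : R := (2 * x - 1) * J + h.

(* The formula is meaningful on all of R, since 0 < g < 1; derivatives are
   taken on R and only the maximization is restricted to [0, 1]. *)
Definition ptilde (R : realType) (J h m : R) : R :=
  - J * m ^+ 2
  - (1 - g (tau J h m) + ln (1 - g (tau J h m))) / 2.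

Definition maximizers (R : realType) (J h : R) : set R :=
  [set m | m \in `[0, 1] /\
           forall x : R, x \in `[0, 1] -> ptilde J h x <= ptilde J h m].

Definition unique_maximizer (R : realType) (J h m0 : R) : Prop :=
  maximizers J h = [set m0].

Definition two_maximizers (R : realType) (J h : R) : Prop :=
  exists m1 m2 : R, m1 != m2 /\ maximizers J h = [set m1; m2].

Definition Jc (R : realType) : R := (4 * (3 - 2 * Num.sqrt 2))^-1.

Definition hc (R : realType) : R := ln (2 * Num.sqrt 2 - 2) / 2 - 4^-1.

Definition mc (R : realType) : R := 2 - Num.sqrt 2.

(* Only the values of gamma on [Jc, +oo[ are relevant. *)
Definition Gamma (R : realType) (gamma : R -> R) : set (R * R) :=
  [set Jh | Jc R < Jh.1 /\ Jh.2 = gamma Jh.1].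

(* The properties by which the curve gamma is introduced; they determine its
   values on [Jc, +oo[. *)
Definition coexistence_curve (R : realType) (gamma : R -> R) : Prop :=
  [/\ gamma (Jc R) = hc R,
      forall J h : R, 0 < J -> ~ Gamma gamma (J, h) ->
        exists m0 : R, unique_maximizer J h m0
    & forall J h : R, 0 < J -> Gamma gamma (J, h) -> two_maximizers J h].

Definition normal_cdf (R : realType) (v z : R) : R :=
  fine (normal_prob 0 (Num.sqrt v) `]-oo, z]).

Definition quartic_normalizer (R : realType) (l : R) : R :=
  (\int[@lebesgue_measure R]_(x in setT) expR (- (l * x ^+ 4) / 24))^-1.

Definition quartic_pdf (R : realType) (l x : R) : R :=
  quartic_normalizer l * expR (- (l * x ^+ 4) / 24).

Definition quartic_cdf (R : realType) (l z : R) : R :=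
  \int[@lebesgue_measure R]_(x in `]-oo, z]) quartic_pdf l x.

(* The supremum is taken in \bar R, where it needs no boundedness proviso. *)
Definition kolmogorov_dist (R : realType) (F G : R -> R) : \bar R :=
  ereal_sup (range (fun z : R => `|F z - G z|%:E)).

(* Main.v *)
Require Import Defs.
From HB Require Import structures.
From mathcomp Require Import all_boot all_order all_algebra.
From mathcomp Require Import all_classical all_reals all_analysis.
From mathcomp Require Import measurable_realfun.
From mathcomp Require Import zify ring lra.

Import Order.TTheory GRing.Theory Num.Theory.
Import numFieldNormedType.Exports.

Set Implicit Arguments.
Unset Strict Implicit.
Unset Printing Implicit Defensive.

Local Open Scope classical_set_scope.
Local Open Scope ring_scope.

(** The number of configurations of [k] dimers on [N] vertices is
    [N! / (k! * 2 ^ k * (N - 2 k)!)], so under the Gibbs measure the number [n] of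
    monomers has an explicit weight. Up to a factor depending on [N] alone, this
    weight is [exp (N * I (n / N) - s k - s n)] exactly, with [k] the number of
    dimers ([weight_as_rate]), where [I] is the function [rate] and
    [s n = ln n! - n ln n + n] is a slowly varying correction. The theorem is a
    local limit theorem for these weights, with an explicit rate, followed by
    summation.

    The function [ptilde] is obtained from [I] by replacing its convex term
    [J x ^ 2] by the tangents [J (2 m x - m ^ 2)] and maximizing over [x]. Hence
    [I <= ptilde] on [0, 1] ([rate_le_ptilde]), with equality at a maximizer [m0]
    of [ptilde], which satisfies [g (tau m0) = m0] ([maximizer_fixpoint]). So [m0]
    is also the unique maximizer of [I], with a quantitative gap ([rate_gap]). The
    Taylor coefficients of [I] at [m0] are rational functions of [m0] and [J]
    ([rate_taylor]). At a maximum the quadratic coefficient has a sign, and if it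
    vanishes, so does the cubic one; this happens only at [(Jc, hc)]
    ([quad_gt0]). Comparing with the derivatives of [ptilde] identifies [lambda]
    and [lambdac] ([variance_quad], [fourth_derivative_quart]).

    Both regimes are treated at once: let [p = 2] or [p = 4] be the order of the
    first term of the expansion [I (m0 + e) - I m0 = - kap * e ^ p + ...], let
    [t ^ p = N], and let [u = (n - N m0) / t ^ (p - 1)] be the rescaled number of
    monomers. Then [N * e ^ p = u ^ p], the Taylor remainder contributes
    [|u| ^ (p + 1) / t] to the exponent, and the variation of [s] contributes
    [(1 + |u|) / t]. So each weight, divided by a factor common to all of them,
    equals [exp (- kap |u| ^ p)] up to an error of order [1 / (t (1 + u ^ 2))]
    ([rel_weight_profile]). The rescaled lattice has step at most [2 / t], so
    Riemann sums converge at the same rate, and the errors are summable because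
    [1 / (1 + u ^ 2)] telescopes under [atan] ([lattice_cdf]). The resulting rate [1 / t] is [N ^ (-1/2)] or [N ^ (-1/4)]. *)

(** * Counting dimer configurations *)

Section CountDimers.
Local Open Scope nat_scope.
Local Open Scope set_scope.
Variable N : nat.
Implicit Types (D : {set {set 'I_N}}) (e : {set 'I_N}).

Definition dimers_of_size k : {set {set {set 'I_N}}} :=
  [set D | is_dimer D & #|D| == k].

Lemma card_cover_dimer D : is_dimer D -> #|finset.cover D| = (#|D| * 2)%N.
Proof.
case/andP=> /fintype.subsetP sD /eqP <-; rewrite (eq_bigr (fun=> 2%N)) ?sum_nat_const //.
by move=> e /sD; rewrite inE => /eqP.
Qed.

Lemma card_monomers D : is_dimer D -> (#|D| * 2 + #|monomers D| = N)%N.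
Proof. by move=> dD; rewrite -card_cover_dimer // finset.cardsC card_ord. Qed.

Lemma is_dimerD1 D e : is_dimer D -> is_dimer (D :\ e).
Proof.
case/andP=> sD tD; rewrite /is_dimer (fintype.subset_trans (finset.subsetDl _ _) sD).
exact: finset.trivIsetS (finset.subsetDl _ _) tD.
Qed.

Lemma sub_monomersD1 D e : is_dimer D -> e \in D -> e \subset monomers (D :\ e).
Proof.
case/andP=> _ /finset.trivIsetP tD eD; apply/fintype.subsetP=> x xe; rewrite inE.
apply/finset.bigcupP=> -[B]; rewrite !inE => /andP[Be BD] xB.
by have /pred0P/(_ x) := tD _ _ BD eD Be; rewrite /= xB xe.
Qed.

Lemma is_dimerU1 D e : is_dimer D -> e \subset monomers D -> #|e| = 2%N ->
  is_dimer (e |: D) /\ e \notin D.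
Proof.
move=> dD se e2; have/andP[sD tD] := dD.
have eND : e \notin D.
  apply/negP=> eD; have /card_gt0P[x xe] : (0 < #|e|)%N by rewrite e2.
  move/fintype.subsetP: se => /(_ _ xe); rewrite inE => /finset.bigcupP; case.
  by exists e.
split=> //; rewrite /is_dimer finset.subUset finset.sub1set inE e2 eqxx sD /=.
apply/finset.trivIsetP=> A B; rewrite !inE.
have disj C : C \in D -> fintype.disjoint (mem e) (mem C).
  move=> CD; rewrite -finset.setI_eq0; apply/eqP/finset.setP=> x; rewrite !inE.
  apply/negP=> /andP[xe xC]; move/fintype.subsetP: se => /(_ _ xe); rewrite inE.
  by move/finset.bigcupP; case; exists C.
case/orP=> [/eqP->|AD] /orP[/eqP->|BD] AB.
- by rewrite eqxx in AB.
- exact: disj.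
- by rewrite fintype.disjoint_sym disj.
- exact: (finset.trivIsetP tD).
Qed.

(** Both sides count the pairs formed by a configuration of [k.+1] dimers and
    one of its dimers: removing that dimer leaves [k] dimers and two
    distinguished monomers. *)
Lemma double_count_dimers k :
  (#|dimers_of_size k.+1| * k.+1 = #|dimers_of_size k| * 'C(N - k * 2, 2))%N.
Proof.
pose A := [set p : {set {set 'I_N}} * {set 'I_N} |
  (p.1 \in dimers_of_size k.+1) && (p.2 \in p.1)].
pose B := [set p : {set {set 'I_N}} * {set 'I_N} |
  (p.1 \in dimers_of_size k) && ((p.2 \subset monomers p.1) && (#|p.2| == 2%N))].
pose f (p : {set {set 'I_N}} * {set 'I_N}) := ((p.1 :\ p.2), p.2).
have cA : #|A| = (#|dimers_of_size k.+1| * k.+1)%N.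
  rewrite -sum1_card (eq_bigl (fun p => (p.1 \in dimers_of_size k.+1) && (p.2 \in p.1)));
    last by move=> p; rewrite inE.
  rewrite -(pair_big_dep (fun D => D \in dimers_of_size k.+1)
    (fun D e => e \in D) (fun _ _ => 1%N)) /= -sum_nat_const.
  by apply: eq_bigr => D; rewrite inE sum1_card => /andP[_ /eqP].
have cB : #|B| = (#|dimers_of_size k| * 'C(N - k * 2, 2))%N.
  rewrite -sum1_card (eq_bigl (fun p : {set {set 'I_N}} * {set 'I_N} =>
    (p.1 \in dimers_of_size k) && ((p.2 \subset monomers p.1) && (#|p.2| == 2%N))));
    last by move=> p; rewrite inE.
  rewrite -(pair_big_dep (fun D => D \in dimers_of_size k)
    (fun D (e : {set 'I_N}) => (e \subset monomers D) && (#|e| == 2%N)) (fun _ _ => 1%N)) /=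
    -sum_nat_const.
  apply: eq_bigr => D; rewrite inE => /andP[dD /eqP Dk].
  have -> : (N - k * 2 = #|monomers D|)%N by have := card_monomers dD; rewrite Dk; lia.
  rewrite sum1_card -cards_draws.
  by apply: eq_card => e; rewrite !inE.
have fAB : finset.imset f (mem A) = B.
  apply/finset.setP=> -[D e]; rewrite !inE /=; apply/finset.imsetP/idP.
    case=> -[D' e']; rewrite !inE /= => /andP[/andP[dD' /eqP D'k] e'D'] [-> ->].
    rewrite is_dimerD1 // sub_monomersD1 //=.
    rewrite (cardsD1 e') e'D' in D'k.
    move: D'k; rewrite add1n => -[->]; rewrite eqxx /=.
    by case/andP: dD' => /fintype.subsetP/(_ _ e'D'); rewrite inE.
  case/andP=> /andP[dD /eqP Dk] /andP[se /eqP e2].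
  have [dU eND] := is_dimerU1 dD se e2.
  exists ((e |: D), e); last by congr pair; rewrite /= finset.setU1K.
  by rewrite inE /= inE dU cardsU1 eND Dk eqxx !inE eqxx.
rewrite -cA -cB -fAB card_in_imset // => -[D e] [D' e']; rewrite !inE /=.
by case/andP=> _ eD /andP[_ eD'] [DD' ee]; move: DD' eD'; rewrite -ee => DD' eD';
   rewrite -(finset.setD1K eD) DD' finset.setD1K.
Qed.

Lemma card_dimers_of_size k : (k * 2 <= N)%N ->
  (#|dimers_of_size k| * (k`! * 2 ^ k * (N - k * 2)`!) = N`!)%N.
Proof.
elim: k => [_|k IH kN].
  rewrite mul0n subn0 fact0 expn0 !mul1n.
  suff -> : #|dimers_of_size 0| = 1%N by rewrite mul1n.
  rewrite -(cards1 (finset.set0 : {set {set 'I_N}})); apply: eq_card => D.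
  rewrite !inE cards_eq0 /is_dimer; case: eqP => [->|_]; last by rewrite andbF.
  by rewrite finset.sub0set andbT; apply/finset.trivIsetP=> A B; rewrite inE.
have kN' : (k * 2 <= N)%N by lia.
rewrite -(IH kN') factS expnS.
have -> : (N - k * 2 = (N - k.+1 * 2).+2)%N by lia.
set n := (N - k.+1 * 2)%N.
have := double_count_dimers k.
have -> : (N - k * 2 = n.+2)%N by rewrite /n; lia.
rewrite bin2 /= => H.
have e2 : ((n.+2 * n.+1)./2 * 2 = n.+2 * n.+1)%N.
  rewrite muln2 -[RHS]odd_double_half oddM /=.
  by case: (odd n).
have -> : (#|dimers_of_size k.+1| * (k.+1 * k`! * (2 * 2 ^ k) * n`!) =
   (#|dimers_of_size k.+1| * k.+1) * 2 * (k`! * 2 ^ k * n`!))%N by ring.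
rewrite H !factS.
transitivity (#|dimers_of_size k| * ((n.+2 * n.+1)./2 * 2) * (k`! * 2 ^ k * n`!))%N.
  by ring.
by rewrite e2; ring.
Qed.

End CountDimers.

(** * Stirling defects and the rate function *)

Section Stirling.
Variable R : realType.
Implicit Types (x y : R) (m n k : nat).

Lemma ln_le_subr1 x : 0 < x -> ln x <= x - 1.
Proof. by move=> x0; have := @le_ln1Dx R (x - 1); rewrite (addrC 1) subrK; apply; lra. Qed.

Lemma ln_ge_1subV x : 0 < x -> 1 - x^-1 <= ln x.
Proof.
move=> x0; have := @ln_le_subr1 x^-1; rewrite invr_gt0 => /(_ x0).
by rewrite lnV ?posrE //; lra.
Qed.

(** The error of the crude Stirling approximation [ln n! ~ n ln n - n]. *)
Definition stirling_defect n : R := ln (n`!%:R) - n%:R * ln n%:R + n%:R.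

(** Both inequalities come from [1 - x^-1 <= ln x <= x - 1] at
    [x = n.+1%:R / n%:R]. *)
Lemma stirling_defect_step n : (0 < n)%N ->
  stirling_defect n <= stirling_defect n.+1 /\
  stirling_defect n.+1 - ln n.+1%:R <= stirling_defect n - ln n%:R.
Proof.
move=> n0; have nR : 0 < n%:R :> R by rewrite ltr0n.
have n1R : 0 < n.+1%:R :> R by rewrite ltr0n.
have fR : 0 < n`!%:R :> R by rewrite ltr0n fact_gt0.
rewrite /stirling_defect factS natrM lnM ?posrE //.
have ub := @ln_le_subr1 (n.+1%:R / n%:R) (divr_gt0 n1R nR).
have lb := @ln_ge_1subV (n.+1%:R / n%:R) (divr_gt0 n1R nR).
rewrite ln_div ?posrE // in ub lb.
have e1 : n.+1%:R / n%:R - 1 = n%:R^-1 :> R.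
  by rewrite -natr1; field; rewrite ?gt_eqF.
have e2 : 1 - (n.+1%:R / n%:R)^-1 = n.+1%:R^-1 :> R.
  rewrite -natr1 in n1R *; field; rewrite ?gt_eqF //.
rewrite e1 in ub; rewrite e2 in lb.
have ub' : n%:R * (ln n.+1%:R - ln n%:R) <= 1 :> R.
  by rewrite mulrC -ler_pdivlMr // div1r.
have lb' : 1 <= n.+1%:R * (ln n.+1%:R - ln n%:R) :> R.
  by rewrite mulrC -ler_pdivrMr // div1r.
rewrite -natr1 in lb' ub' *; split; lra.
Qed.

Lemma stirling_defect0 : stirling_defect 0 = 0.
Proof. by rewrite /stirling_defect fact0 ln1 mul0r; lra. Qed.

Lemma stirling_defect1 : stirling_defect 1 = 1.
Proof. by rewrite /stirling_defect (_ : 1`! = 1%N) // ln1; lra. Qed.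

Lemma stirling_defect_mono m n : (m <= n)%N -> stirling_defect m <= stirling_defect n.
Proof.
elim: n => [|n IH]; first by rewrite leqn0 => /eqP ->.
rewrite leq_eqVlt => /predU1P[->//|]; rewrite ltnS => /IH mn.
apply: le_trans mn _; case: n {IH} => [|n]; last by case: (@stirling_defect_step n.+1).
by rewrite stirling_defect0 stirling_defect1 ler01.
Qed.

Lemma stirling_defectBln_anti m n : (0 < m)%N -> (m <= n)%N ->
  stirling_defect n - ln n%:R <= stirling_defect m - ln m%:R.
Proof.
move=> m0; elim: n => [|n IH]; first by rewrite leqn0 => /eqP mE; rewrite mE in m0.
rewrite leq_eqVlt => /predU1P[->//|]; rewrite ltnS => mn.
by apply: le_trans (IH mn); case: (@stirling_defect_step n (leq_trans m0 mn)).
Qed.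

Lemma stirling_defect_ge0 n : 0 <= stirling_defect n.
Proof. by rewrite -stirling_defect0 stirling_defect_mono. Qed.

Lemma stirling_defect_le n : (0 < n)%N -> stirling_defect n <= 1 + ln n%:R.
Proof.
move=> n0; have := stirling_defectBln_anti (ltn0Sn 0) n0.
by rewrite stirling_defect1 ln1; lra.
Qed.

(** The two monotonicities confine an increment of the defect between [0] and the
    increment of [ln], so no asymptotic expansion of the factorial is needed. *)
Lemma stirling_defect_lip (c : R) m n : 0 < c -> c <= m%:R -> c <= n%:R ->
  `|stirling_defect m - stirling_defect n| <= `|m%:R - n%:R| / c.
Proof.
wlog mn : m n / (m <= n)%N => [hw|] c0 cm cn.
  case/orP: (leq_total m n) => mn; first exact: hw.
  by rewrite distrC [`|m%:R - _|]distrC; apply: hw.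
have m0R : 0 < m%:R :> R by exact: lt_le_trans c0 cm.
have n0R : 0 < n%:R :> R by exact: lt_le_trans c0 cn.
have m0 : (0 < m)%N by rewrite -(ltr0n R).
have a1 := stirling_defect_mono mn; have a2 := stirling_defectBln_anti m0 mn.
have mnR : m%:R <= n%:R :> R by rewrite ler_nat.
rewrite ler0_norm ?subr_le0 // [`|m%:R - _|]ler0_norm ?subr_le0 //.
have := @ln_le_subr1 (n%:R / m%:R) (divr_gt0 n0R m0R).
rewrite ln_div ?posrE //.
have -> : n%:R / m%:R - 1 = (n%:R - m%:R) / m%:R :> R by field; rewrite gt_eqF.
have : (n%:R - m%:R) / m%:R <= (n%:R - m%:R) / c :> R.
  by rewrite ler_wpM2l ?subr_ge0 // lef_pV2 ?posrE.
rewrite !opprB; lra.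
Qed.

End Stirling.

Section RateFunction.
Variable R : realType.
Implicit Types (J h x : R) (N n k : nat).

(** The exponential rate of the total Gibbs weight of the configurations with
    monomer density [x], in the normalization for which it lies below
    [ptilde] and touches it at the critical points of [ptilde]. *)
Definition rate J h x : R :=
  - (1 - x) * ln (1 - x) / 2 - x * ln x - (1 - x) / 2 + (h - J) * x + J * x ^+ 2.

(** The part of the logarithm of the weight that depends on [N] alone. *)
Definition log_scale N : R := ln (N`!%:R) - N%:R * ln N%:R / 2 + N%:R.

(** The identity is exact: what Stirling's formula leaves out is kept in the two
    defects. *)
Lemma weight_as_rate J h N n k : (0 < N)%N -> (k * 2 + n = N)%N ->
  N`!%:R / (k`! * 2 ^ k * n`!)%:R *
    expR (N%:R * (J * (n%:R / N%:R) ^+ 2 + (ln N%:R / 2 + h - J) * (n%:R / N%:R))) =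
  expR (log_scale N + N%:R * rate J h (n%:R / N%:R)
        - stirling_defect R k - stirling_defect R n).
Proof.
move=> N0 knN.
have NR : 0 < N%:R :> R by rewrite ltr0n.
have N0' : N%:R != 0 :> R by rewrite gt_eqF.
have f0 i : 0 < i`!%:R :> R by rewrite ltr0n fact_gt0.
have p0 : 0 < (2 ^ k)%N%:R :> R by rewrite ltr0n expn_gt0.
have kE : k%:R * 2 = N%:R - n%:R :> R by rewrite -knN natrD natrM; lra.
(* Multiplying by [k] or [n] makes these hold also when the logarithm is taken
   at zero. *)
have lnk : k%:R * ln (N%:R * (1 - n%:R / N%:R)) = k%:R * (ln k%:R + ln 2) :> R.
  have -> : N%:R * (1 - n%:R / N%:R) = k%:R * 2 :> R by rewrite kE; field.
  case: k {knN p0 kE} => [|k]; first by rewrite !mul0r.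
  by rewrite lnM // posrE ltr0n.
have lnk2 : k%:R * ln (N%:R * (1 - n%:R / N%:R)) =
    k%:R * (ln N%:R + ln (1 - n%:R / N%:R)) :> R.
  case: k {knN p0 lnk} kE => [|k] kE; first by rewrite !mul0r.
  rewrite lnM // posrE //.
  have -> : 1 - n%:R / N%:R = k.+1%:R * 2 / N%:R :> R by rewrite kE; field.
  by rewrite divr_gt0 // mulr_gt0 // ltr0n.
have lnn : n%:R * ln (n%:R / N%:R) = n%:R * (ln n%:R - ln N%:R) :> R.
  case: n {knN lnk lnk2 kE} => [|n]; first by rewrite !mul0r.
  by rewrite ln_div // posrE ltr0n.
have fE i : i`!%:R = expR (ln i`!%:R) :> R by rewrite lnK // posrE.
rewrite !natrM (fE N) (fE k) (fE n) natrX -[2](@lnK R) ?posrE ?ltr0n //.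
rewrite -expRM_natl -!expRD -expRN -!expRD.
congr expR; rewrite (@lnK R 2) ?posrE ?ltr0n // /log_scale /rate /stirling_defect -?fE.
move: lnk lnk2 lnn kE.
set a := ln (k%:R); set b := ln (1 - _); set c := ln (n%:R / _); set d := ln n%:R.
set L := ln N%:R => lnk lnk2 lnn kE.
have nE : n%:R = N%:R - k%:R * 2 :> R by lra.
have e1 : N%:R * (1 - n%:R / N%:R) = k%:R * 2 :> R by rewrite kE; field.
have e2 : N%:R * (n%:R / N%:R) = n%:R :> R by field.
set x := n%:R / N%:R in e1 e2 *.
have -> : N%:R * (J * x ^+ 2 + (L / 2 + h - J) * x) =
  J * x ^+ 2 * N%:R + (L / 2 + h - J) * n%:R by rewrite -e2; ring.
have -> : N%:R * (- (1 - x) * b / 2 - x * c - (1 - x) / 2 + (h - J) * x + J * x ^+ 2)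
  = - (N%:R * (1 - x)) * b / 2 - N%:R * x * c - N%:R * (1 - x) / 2
    + (h - J) * (N%:R * x) + J * x ^+ 2 * N%:R by ring.
rewrite e1 e2 lnn.
have -> : - (k%:R * 2) * b / 2 = - (k%:R * (L + b)) + k%:R * L by field.
rewrite -lnk2 lnk.
have : (N%:R * L = k%:R * 2 * L + n%:R * L :> R) by rewrite nE; ring.
set q := J * _; lra.
Qed.

End RateFunction.

(** * Differentiation rules *)

Section PointwiseDerivation.
Variable R : realType.
Implicit Types (f k : R -> R) (x a b c : R).

(** Unlike [is_derive], this is not a class: the rules below are selected by the
    shape of the function, never by instance resolution. *)
Definition has_derive f x a := is_derive x 1 f a.

Lemma has_derive_eq f x a b : has_derive f x a -> a = b -> has_derive f x b.
Proof. by move=> fa <-. Qed.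

Lemma has_derive_cst c x : has_derive (fun=> c) x 0.
Proof. exact: is_derive_cst. Qed.

Lemma has_derive_id x : has_derive (fun y : R => y) x 1.
Proof. exact: is_derive_id. Qed.

Lemma has_derive_opp f x a : has_derive f x a -> has_derive (fun y => - f y) x (- a).
Proof. by move=> fa; exact: (is_deriveN fa). Qed.

Lemma has_derive_add f k x a b : has_derive f x a -> has_derive k x b ->
  has_derive (fun y => f y + k y) x (a + b).
Proof. by move=> fa kb; exact: (is_deriveD fa kb). Qed.

Lemma has_derive_mul f k x a b : has_derive f x a -> has_derive k x b ->
  has_derive (fun y => f y * k y) x (f x * b + k x * a).
Proof. by move=> fa kb; exact: (is_deriveM fa kb). Qed.

Lemma has_derive_exprn f x a n : has_derive f x a ->
  has_derive (fun y => f y ^+ n) x (n%:R * f x ^+ n.-1 * a).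
Proof.
move=> fa; have h := is_deriveX n fa; rewrite exprfctE in h.
by apply: is_derive_eq h _.
Qed.

Lemma has_derive_inv f x a : f x != 0 -> has_derive f x a ->
  has_derive (fun y => (f y)^-1) x (- (f x) ^- 2 * a).
Proof. by move=> fx fa; exact: (is_deriveV fx fa). Qed.

Lemma has_derive_comp f k x a b : has_derive f (k x) a -> has_derive k x b ->
  has_derive (fun y => f (k y)) x (a * b).
Proof. by move=> fa kb; exact: is_derive1_comp fa kb. Qed.

Lemma has_derive_expRc f x a : has_derive f x a ->
  has_derive (fun y => expR (f y)) x (expR (f x) * a).
Proof. exact/has_derive_comp/is_derive_expR. Qed.

Lemma has_derive_lnc f x a : 0 < f x -> has_derive f x a ->
  has_derive (fun y => ln (f y)) x ((f x)^-1 * a).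
Proof. by move=> f0; exact/has_derive_comp/is_derive1_ln. Qed.

Lemma has_derive_sqrtc f x a : 0 < f x -> has_derive f x a ->
  has_derive (fun y => Num.sqrt (f y)) x ((2 * Num.sqrt (f x))^-1 * a).
Proof. by move=> f0; exact/has_derive_comp/is_derive1_sqrt. Qed.

Lemma mean_value f (df : R -> R) a b : a <= b ->
  (forall x, a <= x <= b -> has_derive f x (df x)) ->
  exists2 c, a <= c <= b & f b - f a = df c * (b - a).
Proof.
move=> ab dfx; have [||c] := @MVT_segment R f df a b ab.
- by move=> x; rewrite in_itv /= => /andP[/ltW ax /ltW xb]; apply: dfx; rewrite ax.
- apply: derivable_within_continuous => x; rewrite in_itv /= => xab.
  by have [] := dfx x xab.
by rewrite in_itv /= => cab e; exists c.
Qed.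

End PointwiseDerivation.

(** * The variational problem *)

Section Variational.
Variable R : realType.
Implicit Types (J h x y m t : R).

Lemma gE t : g t =
  (Num.sqrt (expR (2 * t) ^+ 2 + 4 * expR (2 * t)) - expR (2 * t)) / 2.
Proof.
rewrite /g (_ : 4 * t = 2%:R * (2 * t)); first by rewrite expRM_natl.
by rewrite -[2%:R]/(2 : R); ring.
Qed.

(** [g t] is the positive root of a quadratic equation, whose logarithm [ln_g]
    exhibits [g] as the inverse of [y |-> ln y - ln (1 - y) / 2], the negative of
    the derivative of the entropy. *)
Lemma g_root t : g t ^+ 2 = (1 - g t) * expR (2 * t).
Proof.
rewrite gE; set E := expR (2 * t).
have E0 : 0 < E by exact: expR_gt0.
have : Num.sqrt (E ^+ 2 + 4 * E) ^+ 2 = E ^+ 2 + 4 * E.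
  by rewrite sqr_sqrtr // addr_ge0 ?sqr_ge0 // mulr_ge0 // ltW.
by move: (Num.sqrt _) => w e; field: e.
Qed.

Lemma g_gt0 t : 0 < g t.
Proof.
rewrite gE; set E := expR (2 * t).
have E0 : 0 < E by exact: expR_gt0.
rewrite divr_gt0 // subr_gt0 -[ltLHS]gtr0_norm // -sqrtr_sqr ltr_sqrt.
  by rewrite ltrDl mulr_gt0.
by rewrite ltr_wpDl ?sqr_ge0 // mulr_gt0.
Qed.

Lemma g_lt1 t : g t < 1.
Proof.
have := g_root t; have := g_gt0 t; have := expR_gt0 (2 * t).
set E := expR _; set y := g t => E0 y0 e.
have : 0 < y ^+ 2 by rewrite exprn_gt0.
by rewrite e pmulr_lgt0 // subr_gt0.
Qed.

Lemma ln_g t : t = ln (g t) - ln (1 - g t) / 2.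
Proof.
have g0 := g_gt0 t; have g1 : 0 < 1 - g t by rewrite subr_gt0 g_lt1.
have := congr1 (@ln R) (g_root t).
by rewrite lnXn // (@lnM R (1 - g t)) ?posrE ?expR_gt0 // expRK -mulr_natl => e; lra.
Qed.

(** The Legendre transform of the entropy, evaluated at its optimal point. *)
Lemma ptilde_entropy J h m (y := g (tau J h m)) :
  ptilde J h m = - (1 - y) * ln (1 - y) / 2 - y * ln y - (1 - y) / 2
                 + tau J h m * y - J * m ^+ 2.
Proof.
by rewrite /ptilde -/y (ln_g (tau J h m)) -/y; field.
Qed.

Lemma mul_lnB_ge x y : 0 <= x -> 0 < y -> x - y <= x * (ln x - ln y).
Proof.
rewrite le_eqVlt => /predU1P[<-|x0] y0; first by rewrite mul0r; lra.
have := ln_ge_1subV (divr_gt0 x0 y0); rewrite ln_div ?posrE // invf_div.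
rewrite -(@ler_pM2l _ x) // => le1; apply: le_trans le1.
by rewrite le_eqVlt; apply/orP; left; apply/eqP; field; rewrite gt_eqF.
Qed.

(** [ptilde] is the rate function with its quadratic term [J * x ^+ 2] replaced
    by the tangent [J * (2 * m * x - m ^+ 2)] and then maximized over [x]; the
    tangent at [x] itself gives the bound, by Gibbs' inequality. *)
Lemma rate_le_ptilde J h x : 0 <= x <= 1 -> rate J h x <= ptilde J h x.
Proof.
case/andP=> x0 x1; rewrite ptilde_entropy; set y := g _.
have y0 : 0 < y by exact: g_gt0.
have y1 : 0 < 1 - y by rewrite subr_gt0 g_lt1.
have te : tau J h x = ln y - ln (1 - y) / 2 by exact: ln_g.
have x1' : 0 <= 1 - x by rewrite subr_ge0.
have h1 := mul_lnB_ge x0 y0; have h2 := mul_lnB_ge x1' y1.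
have -> : rate J h x =
  - (1 - x) * ln (1 - x) / 2 - x * ln x - (1 - x) / 2 + tau J h x * x - J * x ^+ 2.
  by rewrite /rate /tau; ring.
rewrite te; lra.
Qed.

Lemma rate_g J h m (y := g (tau J h m)) :
  rate J h y = ptilde J h m + J * (y - m) ^+ 2.
Proof. by rewrite ptilde_entropy -/y /rate /tau; ring. Qed.

(** At a non-critical point [m] the replacement of [m] by [g (tau J h m)] strictly
    increases the objective, so no differentiation is needed. *)
Lemma maximizer_fixpoint J h m : 0 < J -> maximizers J h m ->
  g (tau J h m) = m.
Proof.
move=> J0 [_ mmax]; set y := g (tau J h m).
have y0 : 0 < y by exact: g_gt0.
have y1 : y < 1 by exact: g_lt1.
have yI : 0 <= y <= 1 by rewrite !ltW.
have := le_trans (rate_le_ptilde J h yI) (mmax y _); rewrite in_itv /= yI => /(_ isT).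
rewrite rate_g -/y gerDl pmulr_rle0 // => sq.
by apply/eqP; rewrite -subr_eq0 -sqrf_eq0 eq_le sq sqr_ge0.
Qed.

Lemma maximizer_itv J h m : 0 < J -> maximizers J h m -> 0 < m < 1.
Proof.
by move=> J0 /(maximizer_fixpoint J0) <-; rewrite g_gt0 g_lt1.
Qed.

Lemma maximizer_critical J h m : 0 < J -> maximizers J h m ->
  tau J h m = ln m - ln (1 - m) / 2.
Proof. by move=> J0 /(maximizer_fixpoint J0) {2 3}<-; exact: ln_g. Qed.

Lemma rate_maximizer J h m : 0 < J -> maximizers J h m ->
  rate J h m = ptilde J h m.
Proof.
move=> J0 /(maximizer_fixpoint J0) e.
by rewrite -{1}e rate_g e subrr expr0n mulr0 addr0.
Qed.

(** ** Derivatives of [ptilde] *)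

(** The derivative of [g] as a function of the value of [g]. *)
Definition gslope y : R := 2 * y * (1 - y) / (2 - y).

Lemma has_derive_g t : has_derive (@g R) t (gslope (g t)).
Proof.
have -> : @g R = fun t =>
  (Num.sqrt (expR (2 * t) ^+ 2 + 4 * expR (2 * t)) - expR (2 * t)) / 2.
  by apply/funext => s; exact: gE.
have E0 := expR_gt0 (2 * t).
have w0 : 0 < expR (2 * t) ^+ 2 + 4 * expR (2 * t).
  by rewrite ltr_wpDl ?sqr_ge0 // mulr_gt0.
have dE : has_derive (fun s => expR (2 * s)) t (2 * expR (2 * t)).
  apply: has_derive_eq.
    apply: has_derive_expRc; apply: has_derive_mul; first exact: has_derive_cst.
    exact: has_derive_id.
  by ring.
apply: has_derive_eq.
  apply: has_derive_mul; last exact: has_derive_cst.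
  apply: has_derive_add; last exact: has_derive_opp dE.
  apply: has_derive_sqrtc; first exact: w0.
  apply: has_derive_add.
    exact: has_derive_exprn dE.
  by apply: has_derive_mul dE; exact: has_derive_cst.
have y0 := g_gt0 t; have y1 := g_lt1 t; have yr := g_root t.
have wE := gE t.
move: (Num.sqrt _) wE => w wE.
(* In terms of y = g t both the exponential and the root are rational. *)
have {}wE : w = 2 * g t + expR (2 * t) by rewrite wE; field.
have EE : expR (2 * t) = g t ^+ 2 / (1 - g t).
  by rewrite yr; field; rewrite subr_eq0 eq_sym lt_eqF.
rewrite wE EE /gslope /=; move: (g t) y0 y1 => y y0 y1.
have y1' : 0 < 1 - y by lra.
have y2 : 0 < 2 * y * (1 - y) by rewrite !mulr_gt0.
have y3 : 0 < y ^+ 2 by rewrite exprn_gt0.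
field; apply/and3P; split; rewrite gt_eqF //; first 1 last.
  by rewrite addr_gt0.
rewrite (_ : _ - _ = 2 * (1 - y) + 2 * (1 - y) ^+ 2); last by ring.
by rewrite addr_gt0 ?mulr_gt0 ?exprn_gt0.
Qed.

Lemma has_derive_g_tau J h m :
  has_derive (fun x => g (tau J h x)) m (gslope (g (tau J h m)) * (2 * J)).
Proof.
apply: (@has_derive_comp R (@g R) (tau J h)); first exact: has_derive_g.
apply: has_derive_eq.
  apply: has_derive_add; last exact: has_derive_cst.
  apply: has_derive_mul; last exact: has_derive_cst.
  apply: has_derive_add; last exact: has_derive_cst.
  apply: has_derive_mul; first exact: has_derive_cst.
  exact: has_derive_id.
by rewrite /=; ring.
Qed.

Lemma has_derive_ptilde J h m :
  has_derive (ptilde J h) m (2 * J * (g (tau J h m) - m)).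
Proof.
have g1 : 0 < 1 - g (tau J h m) by rewrite subr_gt0 g_lt1.
have g0 := g_gt0 (tau J h m).
have dg := has_derive_g_tau J h m.
apply: has_derive_eq.
  apply: has_derive_add.
    apply: has_derive_mul; first exact: has_derive_cst.
    by apply: has_derive_exprn; exact: has_derive_id.
  apply: has_derive_opp; apply: has_derive_mul; last exact: has_derive_cst.
  apply: has_derive_add.
    by apply: has_derive_add; [exact: has_derive_cst|exact: has_derive_opp dg].
  apply: has_derive_lnc; first exact: g1.
  by apply: has_derive_add; [exact: has_derive_cst|exact: has_derive_opp dg].
rewrite /gslope /=; move: (g _) g1 g0 => y g1 g0.
field; apply/andP; split; rewrite gt_eqF //; lra.
Qed.

Lemma derive1_of f (df : R -> R) : (forall x, has_derive f x (df x)) ->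
  derive1 f = df.
Proof. by move=> H; apply/funext => x; rewrite derive1E; case: (H x). Qed.

Lemma derive1n1_ptilde J h :
  derive1n 1 (ptilde J h) = fun m => 2 * J * (g (tau J h m) - m).
Proof. exact/derive1_of/has_derive_ptilde. Qed.

Lemma derive1n2_ptilde J h :
  derive1n 2 (ptilde J h) = fun m => 2 * J * (2 * J * gslope (g (tau J h m)) - 1).
Proof.
rewrite derive1nS derive1n1_ptilde; apply: derive1_of => m.
apply: has_derive_eq.
  apply: has_derive_mul; first exact: has_derive_cst.
  apply: has_derive_add; first exact: has_derive_g_tau.
  by apply: has_derive_opp; exact: has_derive_id.
by rewrite /=; ring.
Qed.

End Variational.

(** * Taylor expansion at a maximizer *)

Section Taylor.
Variable R : realType.
Implicit Types (J h x y m e v C : R).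

(** The remainder vanishes at [0] and has derivative [x ^+ 4 / (1 + x)]. *)
Lemma ln1D_taylor v : `|v| <= 2^-1 ->
  `|ln (1 + v) - (v - v ^+ 2 / 2 + v ^+ 3 / 3 - v ^+ 4 / 4)| <= 2 * `|v| ^+ 5.
Proof.
move=> v2; pose r (x : R) := ln (1 + x) - (x - x ^+ 2 / 2 + x ^+ 3 / 3 - x ^+ 4 / 4).
have dr x : `|x| <= 2^-1 -> has_derive r x (x ^+ 4 / (1 + x)).
  rewrite ler_norml => /andP[x1 x2].
  have x0 : 0 < 1 + x by lra.
  apply: has_derive_eq.
    apply: has_derive_add.
      apply: has_derive_lnc; first exact: x0.
      by apply: has_derive_add; [exact: has_derive_cst|exact: has_derive_id].
    apply: has_derive_opp; apply: has_derive_add.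
      apply: has_derive_add.
        apply: has_derive_add; first exact: has_derive_id.
        apply: has_derive_opp; apply: has_derive_mul; last exact: has_derive_cst.
        by apply: has_derive_exprn; exact: has_derive_id.
      apply: has_derive_mul; last exact: has_derive_cst.
      by apply: has_derive_exprn; exact: has_derive_id.
    apply: has_derive_opp; apply: has_derive_mul; last exact: has_derive_cst.
    by apply: has_derive_exprn; exact: has_derive_id.
  by rewrite /=; field; rewrite gt_eqF.
have r0 : r 0 = 0 by rewrite /r addr0 ln1 !expr0n /=; lra.
have bound x : `|x| <= `|v| -> `|x ^+ 4 / (1 + x)| <= 2 * `|v| ^+ 4.
  move=> xv; have := le_trans xv v2; rewrite ler_norml => /andP[x1 x2].
  have x0 : 0 < 1 + x by lra.
  rewrite normrM normfV normrX (gtr0_norm x0) mulrC ler_pM ?invr_ge0 ?(ltW x0) //.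
  - by rewrite -[leRHS]invrK lef_pV2 ?posrE //; lra.
  - by rewrite lerXn2r ?nnegrE.
rewrite -/(r v) exprS.
case: (leP 0 v) => v0.
  have [x xv|c /andP[c0 cv]] := mean_value v0 (df := fun x => x ^+ 4 / (1 + x)) (f := r).
    apply: dr; case/andP: xv => x0 xv; apply: le_trans v2.
    by rewrite !ger0_norm.
  rewrite r0 !subr0 => ->; rewrite normrM [leRHS]mulrCA mulrC ler_wpM2l //.
  by apply: bound; rewrite !ger0_norm.
have [x xv|c /andP[cv c0]] := mean_value (ltW v0) (df := fun x => x ^+ 4 / (1 + x)) (f := r).
  apply: dr; case/andP: xv => xv x0; apply: le_trans v2.
  by rewrite !ler0_norm ?lerN2 // ltW.
rewrite r0 !sub0r => /eqP; rewrite eqr_oppLR => /eqP ->.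
rewrite normrN normrM normrN [leRHS]mulrCA mulrC ler_wpM2l //.
by apply: bound; rewrite !ler0_norm ?lerN2 // ltW.
Qed.

Lemma mul_ln1D_taylor v : `|v| <= 2^-1 ->
  `|(1 + v) * ln (1 + v) - (v + v ^+ 2 / 2 - v ^+ 3 / 6 + v ^+ 4 / 12)|
    <= 4 * `|v| ^+ 5.
Proof.
move=> v2; have := ln1D_taylor v2; set P := _ - _ / 4 => lnP.
have -> : (1 + v) * ln (1 + v) - (v + v ^+ 2 / 2 - v ^+ 3 / 6 + v ^+ 4 / 12) =
  (1 + v) * (ln (1 + v) - P) + - (v ^+ 5 / 4) by rewrite /P; field.
apply: le_trans (ler_normD _ _) _.
rewrite normrN normrM [`|_ / 4|]normrM normrX (@gtr0_norm _ 4^-1) //.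
have v5 : 0 <= `|v| ^+ 5 by rewrite exprn_ge0.
have a2 : `|1 + v| <= 3 / 2 by move: v2; rewrite !ler_norml => /andP[? ?]; apply/andP; lra.
have := ler_pM (normr_ge0 _) (normr_ge0 _) a2 lnP.
by set u := _ * `|_ - P|; lra.
Qed.

(** Up to sign, the Taylor coefficients of the rate function at a critical point
    [m]; the limiting variance away from criticality is [(2 * quad J m)^-1]. *)
Definition quad J m : R := ((2 - m) / (2 * m * (1 - m)) - 2 * J) / 2.
Definition cub m : R := (6 * m ^+ 2)^-1 - (12 * (1 - m) ^+ 2)^-1.
Definition quart m : R := ((1 - m) ^- 3 + 2 / m ^+ 3) / 24.

(** The entropy part of the rate function is built from [v |-> (1 + v) ln (1 + v)],
    with [v = e / m] for the monomers and [v = - e / (1 - m)] for the dimers; the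
    linear terms cancel because [m] is critical. *)
Lemma rate_taylor J h m : 0 < m < 1 -> tau J h m = ln m - ln (1 - m) / 2 ->
  exists2 C, 0 < C & forall e, `|e| <= Num.min m (1 - m) / 2 ->
    `|rate J h (m + e) - rate J h m
      + quad J m * e ^+ 2 - cub m * e ^+ 3 + quart m * e ^+ 4| <= C * `|e| ^+ 5.
Proof.
case/andP=> m0 m1 tc; have m1' : 0 < 1 - m by rewrite subr_gt0.
exists (4 / (1 - m) ^+ 4 + 4 / m ^+ 4).
  by rewrite addr_gt0 // divr_gt0 // exprn_gt0.
move=> e em.
have [em0 em1] : `|e| <= m / 2 /\ `|e| <= (1 - m) / 2.
  by split; apply: le_trans em _; rewrite ler_pM2r // ge_min lexx ?orbT.
set v := e / m; set w := - e / (1 - m).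
have v2 : `|v| <= 2^-1 by rewrite normrM normfV (gtr0_norm m0) ler_pdivrMr //; lra.
have w2 : `|w| <= 2^-1.
  by rewrite normrM normrN normfV (gtr0_norm m1') ler_pdivrMr //; lra.
have v1 : 0 < 1 + v by move: v2; rewrite ler_norml => /andP[? ?]; lra.
have w1 : 0 < 1 + w by move: w2; rewrite ler_norml => /andP[? ?]; lra.
have := mul_ln1D_taylor v2; have := mul_ln1D_taylor w2.
set Pv := v + _ - _ + _; set Pw := w + _ - _ + _ => hw hv.
have e1 : m + e = m * (1 + v) by rewrite /v; field; rewrite gt_eqF.
have e2 : 1 - (m + e) = (1 - m) * (1 + w) by rewrite /w; field; rewrite gt_eqF.
have -> : rate J h (m + e) - rate J h m
      + quad J m * e ^+ 2 - cub m * e ^+ 3 + quart m * e ^+ 4 =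
  - ((1 - m) / 2 * ((1 + w) * ln (1 + w) - Pw)) + - (m * ((1 + v) * ln (1 + v) - Pv)).
  have l1 : ln (m + e) = ln m + ln (1 + v) by rewrite e1 lnM ?posrE.
  have l2 : ln (1 - (m + e)) = ln (1 - m) + ln (1 + w) by rewrite e2 lnM ?posrE.
  rewrite /rate l1 l2.
  have te : h = ln m - ln (1 - m) / 2 - (2 * m - 1) * J by rewrite -tc /tau; ring.
  rewrite te /Pv /Pw /v /w /quad /cub /quart.
  move: (ln m) (ln (1 - m)) (ln (1 + e / m)) (ln (1 + - e / (1 - m))) => a b c d.
  by field; rewrite !gt_eqF.
apply: le_trans (ler_normD _ _) _; rewrite !normrN !(normrM _ (_ - _)).
rewrite (gtr0_norm m0) (@gtr0_norm _ ((1 - m) / 2)) ?divr_gt0 //.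
rewrite [leRHS]mulrDl lerD //.
  apply: le_trans (_ : (1 - m) / 2 * (4 * `|w| ^+ 5) <= _).
    by rewrite ler_wpM2l // divr_ge0 // ltW.
  rewrite normrM normrN normfV (gtr0_norm m1') expr_div_n.
  have e5 : 0 <= `|e| ^+ 5 by rewrite exprn_ge0.
  rewrite (_ : (1 - m) / 2 * _ = 2 / (1 - m) ^+ 4 * `|e| ^+ 5).
    by rewrite ler_wpM2r // ler_pM2r ?invr_gt0 ?exprn_gt0 //; lra.
  by field; rewrite gt_eqF.
apply: le_trans (_ : m * (4 * `|v| ^+ 5) <= _); first by rewrite ler_wpM2l // ltW.
rewrite normrM normfV (gtr0_norm m0) expr_div_n.
rewrite (_ : m * _ = 4 / m ^+ 4 * `|e| ^+ 5) //.
by field; rewrite gt_eqF.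
Qed.

End Taylor.

Section NonDegeneracy.
Variable R : realType.
Implicit Types (J h x y m e : R).

Lemma le0_of_linear_bound (a M eps : R) : 0 < eps ->
  (forall e, 0 < e <= eps -> a <= M * e) -> a <= 0.
Proof.
move=> eps0 H; apply/ler_addgt0Pr => c c0; rewrite add0r.
have M0 : 0 < `|M| + 1 by rewrite ltr_wpDl.
have e0 : 0 < Num.min eps (c / (`|M| + 1)) by rewrite lt_min eps0 divr_gt0.
have := H (Num.min eps (c / (`|M| + 1))); rewrite e0 ge_min lexx /= => /(_ isT) h.
apply: (le_trans h); apply: (@le_trans _ _ (`|M| * (c / (`|M| + 1)))).
  rewrite (le_trans (ler_wpM2r (ltW e0) (ler_norm M))) // ler_wpM2l //.
  by rewrite ge_min lexx orbT.
rewrite mulrA ler_pdivrMr // mulrC ler_wpM2l ?(ltW c0) //; lra.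
Qed.

(** At a maximum the first non-vanishing Taylor coefficient has even order. *)
Lemma max_taylor_coefs (P : R -> R) (q c k C eps : R) : 0 < eps -> 0 < C ->
  (forall e, `|e| <= eps -> P e <= 0) ->
  (forall e, `|e| <= eps ->
    `|P e + q * e ^+ 2 - c * e ^+ 3 + k * e ^+ 4| <= C * `|e| ^+ 5) ->
  0 <= q /\ (q = 0 -> c = 0).
Proof.
move=> eps0 C0 P0 T.
have d0 : 0 < Num.min eps 1 by rewrite lt_min eps0 ltr01.
have key e : 0 < e <= Num.min eps 1 ->
    [/\ 0 < e, e <= 1,
        - q * e ^+ 2 + c * e ^+ 3 <= (`|k| + C) * e ^+ 4 &
        - q * e ^+ 2 - c * e ^+ 3 <= (`|k| + C) * e ^+ 4].
  rewrite le_min => /and3P[e0 e_eps e1].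
  have ne : `|e| = e by rewrite gtr0_norm.
  have nNe : `|- e| = e by rewrite normrN.
  have h1 := T e; have h2 := T (- e); rewrite ne in h1; rewrite nNe in h2.
  move: (h1 e_eps) (h2 e_eps); rewrite !ler_norml => /andP[h1' _] /andP[h2' _].
  have p1 := P0 e; have p2 := P0 (- e); rewrite ne in p1; rewrite nNe in p2.
  move: (p1 e_eps) (p2 e_eps) => p1' p2'.
  have e4 : 0 <= e ^+ 4 by rewrite exprn_ge0 // ltW.
  have k4 : k * e ^+ 4 <= `|k| * e ^+ 4 by rewrite ler_wpM2r // ler_norm.
  have e5 : C * e ^+ 5 <= C * e ^+ 4.
    by rewrite ler_pM2l // exprS ler_piMl.
  have n3 : (- e) ^+ 3 = - e ^+ 3 by ring.
  have n2 : (- e) ^+ 2 = e ^+ 2 by ring.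
  have n4 : (- e) ^+ 4 = e ^+ 4 by ring.
  rewrite n2 n3 n4 in h2'.
  by split=> //; lra.
have q0 : 0 <= q.
  rewrite -oppr_le0; apply: (@le0_of_linear_bound _ (`|k| + C) _ d0) => e /key[e0 e1 h1 h2].
  have : - q * e ^+ 2 <= (`|k| + C) * e * e ^+ 2.
    have : (`|k| + C) * e ^+ 4 <= (`|k| + C) * e ^+ 3.
      by rewrite ler_wpM2l ?addr_ge0 ?(ltW C0) // [e ^+ 4]exprS ler_piMl ?exprn_ge0 ?(ltW e0).
    rewrite -mulrA -exprS; lra.
  by rewrite ler_pM2r ?exprn_gt0.
split=> // q00; apply/eqP; rewrite eq_le; apply/andP; split.
  apply: (@le0_of_linear_bound _ (`|k| + C) _ d0) => e /key[e0 e1 h1 h2].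
  have : c * e ^+ 3 <= (`|k| + C) * e * e ^+ 3
    by move: h1 h2; rewrite q00 oppr0 mul0r -mulrA -exprS; lra.
  by rewrite ler_pM2r ?exprn_gt0.
rewrite -oppr_le0; apply: (@le0_of_linear_bound _ (`|k| + C) _ d0) => e /key[e0 e1 h1 h2].
have : - c * e ^+ 3 <= (`|k| + C) * e * e ^+ 3
    by move: h1 h2; rewrite q00 oppr0 mul0r -mulrA -exprS; lra.
by rewrite ler_pM2r ?exprn_gt0.
Qed.

Let s : R := Num.sqrt 2.

Let s2 : s ^+ 2 = 2.
Proof. by rewrite sqr_sqrtr. Qed.

Let s_bounds : 7 / 5 < s < 3 / 2.
Proof.
have s0 : 0 <= s by exact: sqrtr_ge0.
by apply/andP; split; rewrite -(@ltr_pXn2r _ 2) ?nnegrE // ?s2 //; lra.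
Qed.

Lemma mc_itv : 0 < mc R < 1.
Proof. by rewrite /mc -/s; case/andP: s_bounds => ? ?; apply/andP; split; lra. Qed.

(** The cubic coefficient vanishes when [m = Num.sqrt 2 * (1 - m)]. *)
Lemma cub_eq0 m : 0 < m < 1 -> (cub m == 0) = (m == mc R).
Proof.
case/andP=> m0 m1; have m1' : 0 < 1 - m by rewrite subr_gt0.
case/andP: s_bounds => s7 s3.
have -> : cub m = (s * (1 - m) - m) * ((s * (1 - m) + m) / (12 * m ^+ 2 * (1 - m) ^+ 2)).
  transitivity ((s ^+ 2 * (1 - m) ^+ 2 - m ^+ 2) / (12 * m ^+ 2 * (1 - m) ^+ 2)).
    by rewrite s2 /cub; field; rewrite !gt_eqF.
  by field; rewrite !gt_eqF.
have pos : 0 < (s * (1 - m) + m) / (12 * m ^+ 2 * (1 - m) ^+ 2).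
  by rewrite divr_gt0 ?addr_gt0 ?mulr_gt0 ?exprn_gt0 //; lra.
rewrite mulf_eq0 [X in _ || X]gt_eqF // orbF /mc -/s -[RHS]subr_eq0.
have -> : s * (1 - m) - m = - (1 + s) * (m - (2 - s)).
  transitivity (- (1 + s) * m + 2 + s - s ^+ 2); last by ring.
  by rewrite s2; ring.
by rewrite mulf_eq0 oppr_eq0 gt_eqF //; lra.
Qed.

Lemma quad_mc J : (quad J (mc R) == 0) = (J == Jc R).
Proof.
case/andP: s_bounds => s7 s3.
have sE : s * s = 2 by rewrite -expr2.
rewrite /quad /mc /Jc -/s.
have -> : (2 - (2 - s)) / (2 * (2 - s) * (1 - (2 - s))) = (2 * (3 - 2 * s))^-1.
  have -> : 2 * (2 - s) * (1 - (2 - s)) = 2 * (3 - 2 * s) * s.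
    transitivity (2 * (3 * s - 2 - s * s)); first by ring.
    transitivity (2 * (3 * s - 2 * (s * s))); last by ring.
    by rewrite sE; ring.
  by field; rewrite ?gt_eqF //; lra.
have -> : ((2 * (3 - 2 * s))^-1 - 2 * J) / 2 = (4 * (3 - 2 * s))^-1 - J.
  by field; rewrite gt_eqF //; lra.
by rewrite subr_eq0 eq_sym.
Qed.

Lemma hc_of_critical J h : J = Jc R ->
  tau J h (mc R) = ln (mc R) - ln (1 - mc R) / 2 -> h = hc R.
Proof.
case/andP: s_bounds => s7 s3 JE tE.
have [m0 m1] := andP mc_itv; have m1' : 0 < 1 - mc R by rewrite subr_gt0.
have -> : h = ln (mc R) - ln (1 - mc R) / 2 - (2 * mc R - 1) * J by rewrite -tE /tau; ring.
have -> : (2 * mc R - 1) * J = 4^-1.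
  by rewrite JE /Jc /mc -/s; field; rewrite gt_eqF //; lra.
rewrite /hc -/s; congr (_ - _).
have -> : ln (mc R) - ln (1 - mc R) / 2 = (ln (mc R ^+ 2) - ln (1 - mc R)) / 2.
  by rewrite lnXn // -mulr_natl; field.
rewrite -ln_div ?posrE ?exprn_gt0 //; congr (ln _ / 2).
have -> : mc R ^+ 2 = (2 * s - 2) * (1 - mc R).
  rewrite /mc -/s; transitivity (4 - 4 * s + s ^+ 2); first by ring.
  by transitivity (2 * s ^+ 2 - 4 * s + 2); [rewrite s2|]; ring.
by rewrite mulfK // gt_eqF.
Qed.

(** A degenerate maximizer would also have vanishing cubic coefficient, which
    pins down [m], then [J], then [h]. *)
Lemma quad_gt0 J h m : 0 < J -> maximizers J h m -> (J, h) <> (Jc R, hc R) ->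
  0 < quad J m.
Proof.
move=> J0 mx ncrit.
have m01 := maximizer_itv J0 mx; have tc := maximizer_critical J0 mx.
have [m0 m1] := andP m01.
have [C C0 T] := rate_taylor m01 tc.
have eps0 : 0 < Num.min m (1 - m) / 2 by rewrite divr_gt0 // lt_min m0 subr_gt0.
have [|q0 qc] := @max_taylor_coefs (fun e => rate J h (m + e) - rate J h m)
  _ _ _ _ _ eps0 C0 _ T.
  move=> e em; rewrite subr_le0 (rate_maximizer J0 mx).
  have [em0 em1] : `|e| <= m / 2 /\ `|e| <= (1 - m) / 2.
    by split; apply: le_trans em _; rewrite ler_pM2r // ge_min lexx ?orbT.
  have i01 : 0 <= m + e <= 1.
    move: em0 em1; rewrite !ler_norml => /andP[a1 a2] /andP[a3 a4].
    by apply/andP; split; lra.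
  by apply: le_trans (rate_le_ptilde J h i01) _; case: mx => _; apply; rewrite in_itv.
rewrite lt0r q0 andbT; apply/eqP => q00; apply: ncrit.
move/eqP: (qc q00); rewrite cub_eq0 // => /eqP mE.
rewrite mE in q00 tc; move/eqP: q00; rewrite quad_mc => /eqP JE.
by rewrite (hc_of_critical JE tc) JE.
Qed.

Lemma quart_gt0 m : 0 < m < 1 -> 0 < quart m.
Proof.
case/andP=> m0 m1; rewrite /quart divr_gt0 // addr_gt0 //.
  by rewrite invr_gt0 exprn_gt0 // subr_gt0.
by rewrite divr_gt0 // exprn_gt0.
Qed.

Lemma variance_quad J h m : 0 < J -> maximizers J h m -> 0 < quad J m ->
  - (derive1n 2 (ptilde J h) m)^-1 - (2 * J)^-1 = (2 * quad J m)^-1.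
Proof.
move=> J0 mx; rewrite derive1n2_ptilde (maximizer_fixpoint J0 mx).
have [m0 m1] := andP (maximizer_itv J0 mx).
have m1' : 0 < 1 - m by rewrite subr_gt0.
have m2 : 0 < 2 - m by lra.
have mm : 0 < 2 * m * (1 - m) by rewrite !mulr_gt0.
rewrite /quad /gslope => q0.
have k : 0 < (2 - m) - 2 * J * (2 * m * (1 - m)).
  move: q0; rewrite pmulr_lgt0 // subr_gt0 ltr_pdivlMr // => ?; lra.
have k' : 2 * J * (2 * m * (1 - m)) + -1 * (2 - m) != 0.
  by rewrite lt_eqF //; lra.
by field; rewrite k' !gt_eqF //; lra.
Qed.

(** ** The fourth derivative *)

Lemma has_derive_gslope y : y < 2 -> has_derive (@gslope R) y (2 - 4 / (2 - y) ^+ 2).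
Proof.
move=> y2; have y2' : 2 - y != 0 by rewrite subr_eq0 gt_eqF.
apply: has_derive_eq.
  apply: has_derive_mul.
    apply: has_derive_mul.
      by apply: has_derive_mul; [exact: has_derive_cst|exact: has_derive_id].
    apply: has_derive_add; first exact: has_derive_cst.
    by apply: has_derive_opp; exact: has_derive_id.
  apply: has_derive_inv; first exact: y2'.
  apply: has_derive_add; first exact: has_derive_cst.
  by apply: has_derive_opp; exact: has_derive_id.
by rewrite /=; field.
Qed.

Lemma derive1n3_ptilde J h : derive1n 3 (ptilde J h) = fun m =>
  let y := g (tau J h m) in 8 * J ^+ 3 * ((2 - 4 / (2 - y) ^+ 2) * gslope y).
Proof.
rewrite derive1nS derive1n2_ptilde; apply: derive1_of => m.
apply: has_derive_eq.
  apply: has_derive_mul; first exact: has_derive_cst.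
  apply: has_derive_add; last exact: has_derive_cst.
  apply: has_derive_mul; first exact: has_derive_cst.
  apply: (@has_derive_comp _ (@gslope R)); last exact: has_derive_g_tau.
  by apply: has_derive_gslope; apply: lt_trans (g_lt1 _) _; lra.
by rewrite /=; ring.
Qed.

Lemma derive1n4_ptilde J h m (y := g (tau J h m)) : derive1n 4 (ptilde J h) m =
  16 * J ^+ 4 * (- 8 / (2 - y) ^+ 3 * gslope y + (2 - 4 / (2 - y) ^+ 2) ^+ 2) * gslope y.
Proof.
rewrite derive1nS derive1n3_ptilde.
have y2 : y < 2 by apply: lt_trans (g_lt1 _) _; lra.
have y2' : 2 - y != 0 by rewrite subr_eq0 gt_eqF.
suff : has_derive (fun x => 8 * J ^+ 3 * ((2 - 4 / (2 - x) ^+ 2) * gslope x)) y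
  (8 * J ^+ 3 * (- 8 / (2 - y) ^+ 3 * gslope y + (2 - 4 / (2 - y) ^+ 2) ^+ 2)).
  move=> d; have [_ e] := @has_derive_comp _ _ (fun x => g (tau J h x)) m _ _ d
    (has_derive_g_tau J h m).
  by rewrite derive1E [LHS]e -/y; ring.
apply: has_derive_eq.
  apply: has_derive_mul; first exact: has_derive_cst.
  apply: has_derive_mul; last exact: has_derive_gslope.
  apply: has_derive_add; first exact: has_derive_cst.
  apply: has_derive_opp; apply: has_derive_mul; first exact: has_derive_cst.
  apply: has_derive_inv; first by rewrite expf_eq0.
  apply: has_derive_exprn; apply: has_derive_add; first exact: has_derive_cst.
  by apply: has_derive_opp; exact: has_derive_id.
by rewrite /=; field.
Qed.

(** At the critical point the derivative of [gslope] vanishes and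
    [2 * J * gslope (mc R) = 1], so that a single term of the fourth derivative
    survives. *)
Lemma fourth_derivative_quart h : maximizers (Jc R) h (mc R) ->
  - derive1n 4 (ptilde (Jc R) h) (mc R) = 24 * quart (mc R).
Proof.
case/andP: s_bounds => s7 s3 mx.
have J0 : 0 < Jc R by rewrite /Jc -/s invr_gt0 mulr_gt0 //; lra.
rewrite derive1n4_ptilde (maximizer_fixpoint J0 mx).
have sE : s ^+ 2 = 2 by exact: s2.
have -> : 2 - mc R = s by rewrite /mc -/s; ring.
rewrite sE /gslope /quart /Jc /mc -/s.
have -> : 2 - (2 - s) = s by ring.
have r : (3 - 2 * s) = (s - 1) ^+ 2.
  by transitivity (s ^+ 2 - 2 * s + 1); [rewrite sE|]; ring.
have r2 : 2 - s = s * (s - 1) by rewrite mulrBr -expr2 sE mulr1.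
rewrite r r2.
have -> : 1 - s * (s - 1) = s - 1 by rewrite -r2; ring.
have s0 : s != 0 by rewrite gt_eqF //; lra.
have s1 : s - 1 != 0 by rewrite gt_eqF //; lra.
have num : (s ^+ 3 + 2) * (s - 1) = 2.
  transitivity (s ^+ 2 * s ^+ 2 - s * s ^+ 2 + 2 * s - 2); first by ring.
  by rewrite sE; ring.
transitivity ((s ^+ 3 + 2) * (s - 1) / (s ^+ 3 * (s - 1) ^+ 4) : R); last first.
  by field; rewrite s0 s1.
by rewrite num; field; rewrite s0 s1.
Qed.

End NonDegeneracy.

(** * The limiting density *)

Section Density.
Variable R : realType.
Implicit Types (x y C : R).

(** The power is dominated by a multiple of [expR (k * (1 + x))], and
    [k * (1 + x) <= 2 * k + k * x ^+ 2]. *)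
Lemma poly_gauss_bounded (k : R) (n : nat) : 0 < k ->
  exists2 C, 0 < C & forall x, 0 <= x -> (1 + x) ^+ n * expR (- (k * x ^+ 2)) <= C.
Proof.
move=> k0; exists ((n.+1%:R / k) ^+ n.+1 * expR (2 * k)).
  by rewrite mulr_gt0 ?expR_gt0 // exprn_gt0 // divr_gt0.
move=> x x0; have y1 : 1 <= 1 + x by lra.
have y0 : 0 < 1 + x by lra.
apply: (@le_trans _ _ ((1 + x) ^+ n.+1 * expR (- (k * x ^+ 2)))).
  by rewrite ler_wpM2r ?expR_ge0 // exprS ler_peMl // exprn_ge0 // ltW.
have -> : (1 + x) ^+ n.+1 = (n.+1%:R / k) ^+ n.+1 * (k * (1 + x) / n.+1%:R) ^+ n.+1.
  by rewrite -exprMn; congr (_ ^+ _); field; rewrite ?gt_eqF ?pnatr_eq0.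
rewrite -[leLHS]mulrA ler_pM2l ?exprn_gt0 ?divr_gt0 //.
apply: (@le_trans _ _ (expR (k * (1 + x)) * expR (- (k * x ^+ 2)))).
  rewrite ler_wpM2r ?expR_ge0 //.
  rewrite [k * (1 + x) in leRHS](_ : _ = n.+1%:R * (k * (1 + x) / n.+1%:R)); last first.
    by field; rewrite ?pnatr_eq0.
  rewrite expRM_natl lerXn2r ?nnegrE ?expR_ge0 //.
    by rewrite divr_ge0 // mulr_ge0 // ltW.
  by apply: le_trans _ (expR_ge1Dx _); rewrite lerDr.
rewrite -expRD ler_expR.
have : 0 <= k * (x - 1) ^+ 2 by rewrite mulr_ge0 ?sqr_ge0 // ltW.
have : 0 <= k * x ^+ 2 by rewrite mulr_ge0 ?sqr_ge0 // ltW.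
have -> : k * (x - 1) ^+ 2 = k * x ^+ 2 - 2 * (k * x) + k by ring.
by rewrite mulrDr; lra.
Qed.

Lemma sqr_le_exprn p x : (1 < p)%N -> 0 <= x -> x ^+ 2 - 1 <= x ^+ p.
Proof.
move=> p1 x0; case: (leP x 1) => x1.
  apply: (@le_trans _ _ 0); last by rewrite exprn_ge0.
  by rewrite subr_le0 exprn_ile1.
apply: (@le_trans _ _ (x ^+ 2)); first by lra.
by apply: ler_weXn2l => //; exact: ltW.
Qed.

(** The limiting densities are proportional to [expow p k], with [p = 2] away
    from the critical point and [p = 4] at it. *)
Definition expow (p : nat) (k x : R) : R := expR (- (k * `|x| ^+ p)).

Lemma expow_gt0 p k x : 0 < expow p k x. Proof. exact: expR_gt0. Qed.

Lemma expow_le1 p k x : 0 < k -> expow p k x <= 1.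
Proof. by move=> k0; rewrite expR_le1 oppr_le0 mulr_ge0 ?exprn_ge0 ?(ltW k0). Qed.

Lemma expow_le_gauss p k x : (1 < p)%N -> 0 < k ->
  expow p k x <= expR k * expR (- (k * `|x| ^+ 2)).
Proof.
move=> p1 k0; rewrite -expRD ler_expR.
have := ler_wpM2l (ltW k0) (sqr_le_exprn p1 (normr_ge0 x)); rewrite mulrBr mulr1.
by lra.
Qed.

Lemma poly_expow_bounded p k n : (1 < p)%N -> 0 < k ->
  exists2 C, 0 < C & forall x, (1 + `|x|) ^+ n * expow p k x <= C.
Proof.
move=> p1 k0; have [C C0 H] := poly_gauss_bounded n k0.
exists (expR k * C); first by rewrite mulr_gt0 ?expR_gt0.
move=> x; apply: le_trans (_ : (1 + `|x|) ^+ n * (expR k * expR (- (k * `|x| ^+ 2))) <= _).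
  by rewrite ler_wpM2l ?expow_le_gauss // exprn_ge0 // addr_ge0.
by rewrite mulrCA ler_wpM2l ?expR_ge0 // H.
Qed.

Lemma exprn_lip (n : nat) x y (c : R) : 0 <= x <= c -> 0 <= y <= c ->
  `|x ^+ n.+1 - y ^+ n.+1| <= n.+1%:R * c ^+ n * `|x - y|.
Proof.
case/andP=> x0 xc /andP[y0 yc]; rewrite subrXX normrM mulrC ler_wpM2r //.
apply: le_trans (ler_norm_sum _ _ _) _.
apply: le_trans (_ : \sum_(i < n.+1) c ^+ n <= _); last first.
  by rewrite sumr_const card_ord mulr_natl.
apply: ler_sum => i _; rewrite normrM !normrX !ger0_norm //.
have -> : c ^+ n = c ^+ (n.+1.-1 - i) * c ^+ i.
  by rewrite -exprD /= subnK // -ltnS.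
by apply: ler_pM; rewrite ?exprn_ge0 // lerXn2r ?nnegrE // (le_trans x0 xc).
Qed.

Lemma expR_lip x y : `|expR x - expR y| <= `|x - y| * (expR x + expR y).
Proof.
wlog xy : x y / x <= y => [hw|].
  case/orP: (le_total x y) => xy; first exact: hw.
  by rewrite distrC [`|x - y|]distrC [expR x + _]addrC; exact: hw.
rewrite !ler0_norm ?subr_le0 ?ler_expR // !opprB.
have h : 1 + (x - y) <= expR x / expR y by rewrite -expRB expR_ge1Dx.
have Ey := expR_gt0 y; have Ex := expR_gt0 x.
rewrite ler_pdivlMr // in h.
apply: (@le_trans _ _ ((y - x) * expR y)); first by lra.
by rewrite ler_wpM2l ?subr_ge0 // lerDr ltW.
Qed.

(** The derivative of [expow p k] decays faster than [(1 + y ^+ 2)^-1], and this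
    bound is stable under shifts of length at most [2]. *)
Lemma expow_lip p k : (1 < p)%N -> 0 < k ->
  exists2 C, 0 < C & forall x y, `|x - y| <= 2 ->
    `|expow p k x - expow p k y| <= C * `|x - y| / (1 + y ^+ 2).
Proof.
case: p => // p p1 k0.
have [C C0 HC] := poly_expow_bounded (p + 2) p1 k0.
have c0 : 0 < k * p.+1%:R * 3 ^+ p by rewrite !mulr_gt0 ?exprn_gt0.
exists (10 * (k * p.+1%:R * 3 ^+ p) * C); first by rewrite !mulr_gt0.
move=> x y xy; have y2 : 0 < 1 + y ^+ 2 by rewrite ltr_pwDl ?sqr_ge0.
rewrite ler_pdivlMr //.
have ab : `| `|x| - `|y| | <= `|x - y| by exact: ler_dist_dist.
have ab2 := le_trans ab xy.
move: ab2; rewrite ler_norml => /andP[ab1 ab2].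
have x0 := normr_ge0 x; have y0 := normr_ge0 y.
have bnd (b : R) : 0 <= b -> `|x| <= 3 * (1 + b) -> `|y| <= 3 * (1 + b) ->
    `|k * `|x| ^+ p.+1 - k * `|y| ^+ p.+1| <=
      k * p.+1%:R * 3 ^+ p * (1 + b) ^+ p * `|x - y|.
  move=> b0 xb yb; rewrite -mulrBr normrM gtr0_norm // -!mulrA ler_wpM2l ?(ltW k0) //.
  have := @exprn_lip p `|x| `|y| (3 * (1 + b)); rewrite x0 y0 xb yb => /(_ isT isT) h.
  apply: (le_trans h); rewrite exprMn -!mulrA !ler_wpM2l ?exprn_ge0 //.
  by lra.
have {}h1 : `|k * `|x| ^+ p.+1 - k * `|y| ^+ p.+1| <=
      k * p.+1%:R * 3 ^+ p * (1 + `|x|) ^+ p * `|x - y| by apply: bnd; lra.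
have {}h2 : `|k * `|x| ^+ p.+1 - k * `|y| ^+ p.+1| <=
      k * p.+1%:R * 3 ^+ p * (1 + `|y|) ^+ p * `|x - y| by apply: bnd; lra.
have hq : `|expow p.+1 k x - expow p.+1 k y| <=
    `|k * `|x| ^+ p.+1 - k * `|y| ^+ p.+1| * (expow p.+1 k x + expow p.+1 k y).
  have := expR_lip (- (k * `|x| ^+ p.+1)) (- (k * `|y| ^+ p.+1)).
  by rewrite -opprD normrN.
have yy : 1 + y ^+ 2 <= (1 + `|y|) ^+ 2.
  by rewrite -real_normK ?num_real // sqrrD; lra.
have yx : (1 + `|y|) ^+ 2 <= 9 * (1 + `|x|) ^+ 2.
  rewrite (_ : 9 * _ = (3 * (1 + `|x|)) ^+ 2); last by ring.
  by rewrite lerXn2r ?nnegrE; lra.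
have qx := HC x; have qy := HC y.
move: (expow p.+1 k x) (expow p.+1 k y) (expow_gt0 p.+1 k x) (expow_gt0 p.+1 k y)
  hq qx qy => u v u0 v0 hq qx qy.
move: h1 h2 hq.
move: (`|k * _ - _| : R) (_ * 3 ^+ p : R) c0 (`|x - y| : R)
  (normr_ge0 (k * `|x| ^+ p.+1 - k * `|y| ^+ p.+1)) (normr_ge0 (x - y)).
move=> D c c0 d D0 d0 h1 h2 hq.
have t1 : D * u * (1 + y ^+ 2) <= 9 * (c * d) * C.
  apply: (@le_trans _ _ (c * (1 + `|x|) ^+ p * d * u * (9 * (1 + `|x|) ^+ 2))).
    apply: ler_pM; [by rewrite mulr_ge0 ?D0 ?(ltW u0)|exact: ltW| |exact: le_trans yy yx].
    by rewrite ler_wpM2r // ltW.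
  rewrite (_ : _ * _ = 9 * (c * d) * ((1 + `|x|) ^+ (p + 2) * u)); last by rewrite exprD; ring.
  by rewrite ler_wpM2l // ?mulr_ge0 // ?mulr_ge0 // ltW.
have t2 : D * v * (1 + y ^+ 2) <= c * d * C.
  apply: (@le_trans _ _ (c * (1 + `|y|) ^+ p * d * v * (1 + `|y|) ^+ 2)).
    apply: ler_pM; [by rewrite mulr_ge0 ?D0 ?(ltW v0)|exact: ltW| |exact: yy].
    by rewrite ler_wpM2r // ltW.
  rewrite (_ : _ * _ = c * d * ((1 + `|y|) ^+ (p + 2) * v)); last by rewrite exprD; ring.
  by rewrite ler_wpM2l // ?mulr_ge0 // ?mulr_ge0 // ltW.
apply: le_trans (ler_wpM2r (ltW y2) hq) _.
by rewrite mulrDr mulrDl; lra.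
Qed.

End Density.

Section DensityIntegral.
Variables (R : realType) (p : nat) (k : R).
Hypotheses (p1 : (1 < p)%N) (k0 : 0 < k).
Implicit Types (x y z a b C : R) (D : set (measurableTypeR R)).
Local Notation mu := (@lebesgue_measure R).
Local Notation q := (expow p k).

Definition mass : R := \int[mu]_(x in setT) q x.
Definition cumul z : R := \int[mu]_(x in `]-oo, z]) q x.

Lemma measurable_expow D : measurable_fun D q.
Proof.
apply: measurable_funTS; apply: measurableT_comp => //=.
apply: measurableT_comp => //=; apply: measurable_funM => //=.
apply: measurable_funX => //=.
Qed.

Let sigma : R := (Num.sqrt k)^-1.

Let sigma0 : sigma != 0.
Proof. by rewrite invr_eq0 sqrtr_eq0 -ltNge. Qed.

Let phi x : R := normal_pdf 0 sigma x.

Let phiE x : phi x = normal_peak sigma * expR (- (k / 2 * x ^+ 2)).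
Proof.
rewrite /phi normal_pdfE // /normal_fun subr0; congr (_ * expR _).
rewrite /sigma exprVn sqr_sqrtr ?ltW // -mulr_natr.
by field; rewrite gt_eqF.
Qed.

(** Comparison with a Gaussian density gives integrability, and the spare factor
    [1 + `|x|] gives the tail bounds. *)
Lemma expow_normal_bound : exists2 C, 0 < C & forall x, (1 + `|x|) * q x <= C * phi x.
Proof.
have k2 : 0 < k / 2 by rewrite divr_gt0.
have [C C0 H] := poly_gauss_bounded 1 k2.
have n0 := normal_peak_gt0 sigma0.
exists (expR k * C / normal_peak sigma); first by rewrite divr_gt0 // mulr_gt0 // expR_gt0.
move=> x; rewrite phiE mulrA divfK ?gt_eqF //.
apply: le_trans (_ : (1 + `|x|) * (expR k * expR (- (k * `|x| ^+ 2))) <= _).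
  by rewrite ler_wpM2l ?expow_le_gauss // addr_ge0.
have -> : - (k * `|x| ^+ 2) = - (k / 2 * `|x| ^+ 2) + - (k / 2 * x ^+ 2).
  by rewrite real_normK ?num_real //; field.
have := H _ (normr_ge0 x); rewrite expr1 expRD => h.
have E0 := expR_ge0 k; have F0 := expR_ge0 (- (k / 2 * x ^+ 2)).
have := ler_wpM2r F0 (ler_wpM2l E0 h).
by rewrite (mulrCA (expR k)) !mulrA.
Qed.

Let integrable_phi D : measurable D -> mu.-integrable D (EFin \o phi).
Proof.
by move=> mD; apply: (integrableS _ _ (@subsetT _ _)) => //; exact: integrable_normal_pdf.
Qed.

Let integrable_Cphi C D : measurable D -> mu.-integrable D (EFin \o (fun x => C * phi x)).
Proof. by move=> mD; have := integrableZl mD C (integrable_phi mD). Qed.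

Lemma integrable_expow D : measurable D -> mu.-integrable D (EFin \o q).
Proof.
move=> mD; have [C C0 H] := expow_normal_bound.
apply: (le_integrable mD _ _ (integrable_Cphi C mD)).
  by apply/measurable_EFinP; exact: measurable_expow.
move=> x _ /=; rewrite lee_fin ger0_norm ?(ltW (expow_gt0 _ _ _)) //.
apply: le_trans (ler_norm _); apply: le_trans (H x).
by rewrite ler_peMl ?(ltW (expow_gt0 _ _ _)) // lerDl.
Qed.

Lemma Rintegral_phi_le1 D : measurable D -> \int[mu]_(x in D) phi x <= 1.
Proof.
move=> mD; rewrite -lee_fin /Rintegral fineK; last first.
  by apply: integrable_fin_num => //; exact: integrable_phi.
rewrite -(@integral_normal_pdf R 0 sigma); apply: ge0_subset_integral => //.
- by apply/measurable_EFinP; exact: measurable_normal_pdf.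
- by move=> x _; rewrite lee_fin normal_pdf_ge0.
Qed.

(** Markov's inequality for the weight [1 + `|x|]; the factor [2] leaves room for
    half-lines that reach slightly beyond the origin. *)
Lemma expow_tail : exists2 C, 0 < C & forall D a, measurable D ->
  (forall x, D x -> a <= 2 * (1 + `|x|)) ->
  a * (\int[mu]_(x in D) q x) <= C.
Proof.
have [C C0 H] := expow_normal_bound.
exists (2 * C); first by rewrite mulr_gt0.
move=> D a mD aD; rewrite -RintegralZl //; last exact: integrable_expow.
apply: (@le_trans _ _ (\int[mu]_(x in D) (2 * C * phi x))).
  apply: le_Rintegral => //.
  - by have := integrableZl mD a (integrable_expow mD).
  - exact: integrable_Cphi.
  - move=> x Dx; apply: (@le_trans _ _ (2 * ((1 + `|x|) * q x))).
      by rewrite mulrA ler_wpM2r ?aD // (ltW (expow_gt0 _ _ _)).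
    by rewrite -mulrA ler_wpM2l.
rewrite RintegralZl //; last exact: integrable_phi.
by rewrite ler_piMr ?Rintegral_phi_le1 // mulr_ge0 // ltW.
Qed.

Lemma cumulB a b : a <= b -> cumul b - cumul a = \int[mu]_(x in `]a, b]) q x.
Proof.
by move=> ab; apply: Rintegral_itvB; rewrite ?bnd_simp //; exact: integrable_expow.
Qed.

Lemma massB a : mass - cumul a = \int[mu]_(x in `]a, +oo[) q x.
Proof.
rewrite /mass -set_itvNyy; apply: Rintegral_itvB; rewrite ?bnd_simp //.
exact: integrable_expow.
Qed.

Lemma cumul_ge0 z : 0 <= cumul z.
Proof. by apply: Rintegral_ge0 => x _; rewrite ltW ?expow_gt0. Qed.

Lemma cumul_le_mass z : cumul z <= mass.
Proof.
by rewrite -subr_ge0 massB; apply: Rintegral_ge0 => x _; rewrite ltW ?expow_gt0.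
Qed.

Lemma cumul_mono a b : a <= b -> cumul a <= cumul b.
Proof.
by move=> ab; rewrite -subr_ge0 cumulB //; apply: Rintegral_ge0 => x _; rewrite ltW ?expow_gt0.
Qed.

Let fine_mu_itv a b : a <= b -> fine (mu `]a, b]) = b - a.
Proof.
move=> ab; rewrite lebesgue_measure_itv /= lte_fin.
by case: ltP => [//|ba] /=; apply/esym/eqP; rewrite subr_eq0 eq_le ab ba.
Qed.

Lemma cumulB_bounds a b (l u : R) : a <= b ->
  (forall x, a <= x <= b -> l <= q x <= u) ->
  l * (b - a) <= cumul b - cumul a <= u * (b - a).
Proof.
move=> ab H; rewrite cumulB // -fine_mu_itv //.
have ifin c : mu.-integrable `]a, b] (EFin \o (fun=> c)).
  apply/integrableP; split; first exact/measurable_EFinP.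
  rewrite /= integral_cst //= lebesgue_measure_itv /= lte_fin.
  by case: ifP => _; rewrite ?mule0 ?ltry // -EFinD -EFinM ltry.
have H' x : a < x <= b -> l <= q x /\ q x <= u.
  by case/andP=> /ltW ax xb; apply/andP; apply: H; rewrite ax.
rewrite -!Rintegral_cst //; apply/andP; split; apply: le_Rintegral => //;
  try exact: integrable_expow.
- by move=> x; rewrite /= in_itv /= => /H' [].
- by move=> x; rewrite /= in_itv /= => /H' [].
Qed.

Lemma mass_gt0 : 0 < mass.
Proof.
have := @cumulB_bounds 0 1 (expR (- k)) 1 ler01; rewrite subr0 !mulr1 => h.
have /andP[{}h _] : expR (- k) <= cumul 1 - cumul 0 <= 1.
  apply: h => x /andP[x0 x1]; apply/andP; split; last exact: expow_le1.
  rewrite /expow ler_expR lerN2 (ger0_norm x0).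
  by apply: ler_piMr; [exact: ltW|exact: exprn_ile1].
have := cumul_le_mass 1; have := cumul_ge0 0; have := expR_gt0 (- k).
by lra.
Qed.

(** First-order quadrature on a short cell, with an error summable over cells. *)
Lemma cumul_cell : exists2 C, 0 < C & forall a (d : R), 0 <= d <= 2 ->
  `|d * q a - (cumul (a + d) - cumul a)| <= C * d ^+ 2 / (1 + a ^+ 2).
Proof.
have [C C0 H] := expow_lip p1 k0; exists C => // a d /andP[d0 d2].
have a2 : 0 < 1 + a ^+ 2 by rewrite ltr_pwDl ?sqr_ge0.
set e := C * d / (1 + a ^+ 2).
have := @cumulB_bounds a (a + d) (q a - e) (q a + e); rewrite lerDl d0 => /(_ isT).
have -> : a + d - a = d by ring.
move=> h; have /andP[h1 h2] : (q a - e) * d <= cumul (a + d) - cumul a <= (q a + e) * d.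
  apply: h => x /andP[ax xd].
  have xa : 0 <= x - a by lra.
  have nxa : `|x - a| = x - a by rewrite ger0_norm.
  have := H x a; rewrite nxa => h; have {}h := h _.
  have : `|q x - q a| <= e.
    apply: (le_trans (h _)); first by lra.
    by rewrite ler_pM2r ?invr_gt0 // ler_pM2l //; lra.
  by rewrite ler_norml => /andP[? ?]; apply/andP; split; lra.
rewrite ler_norml; have -> : C * d ^+ 2 / (1 + a ^+ 2) = e * d by rewrite /e; ring.
by apply/andP; split; lra.
Qed.

Lemma cumul_tail : exists C, [/\ 0 < C,
  forall z, z <= 1 -> cumul z <= C / (1 + `|z|) &
  forall z, 0 <= z -> mass - cumul z <= C / (1 + `|z|)].
Proof.
have [C C0 H] := expow_tail; exists C; split=> // z z1.
  have z0 := normr_ge0 z.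
  rewrite ler_pdivlMr; last by lra.
  rewrite mulrC; apply: H => // x; rewrite /= in_itv /= => xz.
  have := ler_norm x; have := ler_norm (- x); rewrite normrN.
  by case: (leP 0 z) => zs; [rewrite [`|z|]ger0_norm|rewrite [`|z|]ltr0_norm]; lra.
rewrite ger0_norm // ler_pdivlMr; last by lra.
rewrite mulrC massB; apply: H => // x; rewrite /= in_itv /= andbT => zx.
by have := ler_norm x; lra.
Qed.

End DensityIntegral.

(** * From lattice weights to distribution functions *)

Section LatticeSum.
Variable R : realType.
Implicit Types (a u F : nat -> R).

(** Up to one incomplete cell, the increments of [F] over the cells that start
    below [z] telescope. *)
Lemma sum_cells_below (F : R -> R) (u : nat -> R) (z e : R) n :
  {homo F : x y / x <= y} -> {homo u : i j / (i <= j)%N >-> i <= j} ->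
  (forall j, F (u j.+1) - F (u j) <= e) ->
  let D := \sum_(0 <= j < n | u j <= z) (F (u j.+1) - F (u j))
           - (F (Num.min z (u n)) - F (Num.min z (u 0%N))) in
  0 <= D <= e /\ (u n <= z -> D = 0).
Proof.
move=> Fm um Fe /=.
have e0 : 0 <= e by apply: le_trans (Fe 0%N); rewrite subr_ge0 Fm // um.
elim: n => [|n [IH1 IH2]].
  by rewrite big_geq // subrr subrr lexx.
rewrite big_mkcond big_nat_recr //= -big_mkcond /=.
have un : u n <= u n.+1 by exact: um.
case: (leP (u n) z) => uz; last first.
  have uz' : z < u n.+1 := lt_le_trans uz un.
  rewrite (min_idPl (ltW uz')) addr0; rewrite (min_idPl (ltW uz)) in IH1; split => //.
  by move=> h; move: (lt_le_trans uz' h); rewrite ltxx.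
have {}IH2 := IH2 uz; rewrite (min_idPr uz) in IH2.
case: (leP (u n.+1) z) => uz'.
  have -> : \sum_(0 <= j < n | u j <= z) (F (u j.+1) - F (u j)) + (F (u n.+1) - F (u n))
    - (F (u n.+1) - F (Num.min z (u 0%N))) = 0 by lra.
  by rewrite lexx e0.
split; last by [].
have := Fe n; have := Fm _ _ uz; have := Fm _ _ (ltW uz').
by move=> h1 h2 h3; apply/andP; split; lra.
Qed.

(** The errors made on the cells are of order [d / (1 + x ^+ 2)]; they are summed
    by telescoping against the bounded function [atan]. *)
Lemma cauchy_le_atan (x d : R) : 0 <= d <= 2 ->
  d / (1 + x ^+ 2) <= 9 * (atan (x + d) - atan x).
Proof.
case/andP=> d0 d2; have x2 : 0 < 1 + x ^+ 2 by rewrite ltr_pwDl ?sqr_ge0.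
have xd : x <= x + d by rewrite lerDl.
have [y _|c /andP[c1 c2] ->] :=
  @mean_value R (@atan R) (fun y => (1 + y ^+ 2)^-1) _ _ xd; first exact: is_derive1_atan.
have -> : x + d - x = d by ring.
have c2' : 0 < 1 + c ^+ 2 by rewrite ltr_pwDl ?sqr_ge0.
rewrite mulrA [leRHS]mulrC ler_wpM2l // -[9]invrK -invfM lef_pV2 ?posrE //.
  (* 1 + c ^+ 2 <= 9 * (1 + x ^+ 2) as c lies within 2 of x. *)
  have h1 : 0 <= (c - x) * (2 - (c - x)) by rewrite mulr_ge0 //; lra.
  have h2 : 0 <= (4 * x + c - 2 * x) ^+ 2 by exact: sqr_ge0.
  have h3 : 0 <= (2 * x - (c - x)) ^+ 2 by exact: sqr_ge0.
  rewrite ler_pdivrMl //; nra.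
by rewrite mulr_gt0 // invr_gt0.
Qed.

Lemma sum_cauchy_le (u0 d : R) n : 0 <= d <= 2 ->
  \sum_(0 <= j < n) d / (1 + (u0 + d * j%:R) ^+ 2) <= 9 * pi.
Proof.
move=> d02; apply: le_trans (_ : 9 * (atan (u0 + d * n%:R) - atan u0) <= _).
  elim: n => [|n IH]; first by rewrite big_geq // mulr0 addr0 subrr mulr0.
  rewrite big_nat_recr //=; apply: le_trans (lerD IH (cauchy_le_atan _ d02)) _.
  have -> : u0 + d * n.+1%:R = u0 + d * n%:R + d by rewrite -natr1; ring.
  lra.
rewrite ler_pM2l //.
by have := atan_ltpi2 (u0 + d * n%:R); have := atan_gtNpi2 u0; lra.
Qed.

End LatticeSum.

Section LatticeCdf.
Variables (R : realType) (p : nat) (k : R).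
Hypotheses (p1 : (1 < p)%N) (k0 : 0 < k).
Implicit Types (C B E t d z : R) (a : nat -> R).

(** Quadrature and the approximation of the weights cost [d / (t * (1 + u ^+ 2))]
    on each cell, up to a constant; the ends of the lattice lie at a distance of
    order [t] from the origin, so the tails cost [1 / t], and so does the cell
    that contains [z]. *)
Lemma lattice_sum_cumul B : 0 < B -> exists2 E, 0 < E &
  forall t d (u0 : R) n a, 0 < t -> 0 <= d <= 2 -> d * t <= 2 ->
  (forall j, (j < n)%N ->
    `|a j - expow p k (u0 + d * j%:R)| <= B / (t * (1 + (u0 + d * j%:R) ^+ 2))) ->
  u0 <= 1 -> t <= B * (1 + `|u0|) ->
  0 <= u0 + d * n%:R -> t <= B * (1 + `|u0 + d * n%:R|) ->
  (forall z, `|d * (\sum_(0 <= j < n | u0 + d * j%:R <= z) a j) - cumul p k z| <= E / t)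
  /\ `|d * (\sum_(0 <= j < n) a j) - mass p k| <= E / t.
Proof.
move=> B0.
have [C1 C10 cell] := cumul_cell p1 k0.
have [C2 [C20 tail1 tail2]] := cumul_tail p1 k0.
have pi0 := @pi_gt0 R.
pose E1 := (B + 2 * C1) * (9 * pi) : R.
have E10 : 0 < E1 by rewrite mulr_gt0 // ?mulr_gt0 // addr_gt0 // mulr_gt0.
exists (E1 + 2 + 3 * (C2 * B)).
  by have : 0 < C2 * B := mulr_gt0 C20 B0; lra.
move=> t d u0 n a t0 d02 dt ha u01 tu0 un0 tun.
have [d0 d2] := andP d02.
pose u j : R := u0 + d * j%:R.
pose F := cumul p k.
have um : {homo u : i j / (i <= j)%N >-> i <= j}.
  by move=> i j ij; rewrite /u lerD2l ler_wpM2l // ler_nat.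
have uS j : u j.+1 = u j + d by rewrite /u -natr1; ring.
have Fm : {homo F : x y / x <= y} by move=> x y; exact: cumul_mono.
have Fe j : F (u j.+1) - F (u j) <= 2 / t.
  have := @cumulB_bounds R p k p1 k0 (u j) (u j.+1) 0 1; rewrite um // => /(_ isT) h.
  have /andP[_] : 0 * (u j.+1 - u j) <= F (u j.+1) - F (u j) <= 1 * (u j.+1 - u j).
    by apply: h => x _; rewrite expow_le1 // ltW ?expow_gt0.
  move=> {}h; apply: (le_trans h).
  by rewrite mul1r uS addrAC subrr add0r ler_pdivlMr.
have F0 : F (u 0%N) <= C2 * B / t.
  rewrite /u mulr0 addr0; apply: le_trans (tail1 _ u01) _.
  have h : 0 < 1 + `|u0| by rewrite ltr_pwDl.
  rewrite ler_pdivrMr // mulrAC ler_pdivlMr // -mulrA ler_pM2l //.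
have Fn : mass p k - F (u n) <= C2 * B / t.
  apply: le_trans (tail2 _ un0) _.
  have h : 0 < 1 + `|u0 + d * n%:R| by rewrite ltr_pwDl.
  by rewrite ler_pdivrMr // mulrAC ler_pdivlMr // -mulrA ler_pM2l.
have cells (P : pred nat) : `|d * (\sum_(0 <= j < n | P j) a j)
    - \sum_(0 <= j < n | P j) (F (u j.+1) - F (u j))| <= E1 / t.
  rewrite mulr_sumr -sumrB; apply: le_trans (ler_norm_sum _ _ _) _.
  apply: le_trans (_ : (B + 2 * C1) / t * (\sum_(0 <= j < n) d / (1 + u j ^+ 2)) <= _).
    rewrite mulr_sumr big_mkcond /= big_seq_cond [leRHS]big_seq_cond.
    apply: ler_sum => j; rewrite andbT mem_index_iota => /andP[_ jn].
    have uj : 0 < 1 + u j ^+ 2 by rewrite ltr_pwDl ?sqr_ge0.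
    case: ifP => _; last first.
      by rewrite mulr_ge0 // divr_ge0 // ltW // addr_gt0 // mulr_gt0.
    rewrite -(subrK (d * expow p k (u j)) (d * a j)) -addrA.
    apply: le_trans (ler_normD _ _) _.
    rewrite -mulrBr normrM (ger0_norm d0) {1}uS.
    have h1 := ler_wpM2l d0 (ha j jn).
    have h2 := cell (u j) d d02.
    apply: le_trans (lerD h1 h2) _.
    have -> : d * (B / (t * (1 + u j ^+ 2))) = B / t * (d / (1 + u j ^+ 2)).
      by field; rewrite !gt_eqF.
    have h3 : C1 * d ^+ 2 / (1 + u j ^+ 2) <= 2 * C1 / t * (d / (1 + u j ^+ 2)).
      rewrite [leRHS]mulrA; apply: ler_wpM2r; first by rewrite invr_ge0 ltW.
      rewrite expr2 [leLHS]mulrA; apply: ler_wpM2r => //.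
      by rewrite ler_pdivlMr // -mulrA mulrC ler_pM2r.
    by rewrite mulrDl mulrDl; lra.
  have := sum_cauchy_le u0 n d02.
  have -> : E1 / t = (B + 2 * C1) / t * (9 * pi) by rewrite /E1 mulrAC.
  by apply: ler_wpM2l; rewrite divr_ge0 // ltW // addr_gt0 // mulr_gt0.
have tV : 0 <= t^-1 by rewrite invr_ge0 ltW.
have EE : (E1 + 2 + 3 * (C2 * B)) / t = E1 / t + 2 / t + 3 * (C2 * B / t).
  by field; rewrite gt_eqF.
have c2t : 0 <= C2 * B / t by rewrite divr_ge0 ?mulr_ge0 // ltW.
split.
  move=> z.
  have [/andP[D0 D1] _] := @sum_cells_below R F u z (2 / t) n Fm um Fe.
  have := cells (fun j => u j <= z).
  have m0 : 0 <= F (Num.min z (u 0%N)) by exact: cumul_ge0.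
  have m1 : F (Num.min z (u 0%N)) <= F (u 0%N) by apply: Fm; rewrite ge_min lexx orbT.
  have m2 : F (Num.min z (u n)) <= F z by apply: Fm; rewrite ge_min lexx.
  have m3 : F z - F (Num.min z (u n)) <= mass p k - F (u n).
    case: (leP z (u n)) => zu; first by rewrite subrr subr_ge0 cumul_le_mass.
    by rewrite lerD2r cumul_le_mass.
  rewrite EE -/(F z) !ler_norml => /andP[h1 h2].
  by apply/andP; split; lra.
have := cells xpredT.
have -> : \sum_(0 <= j < n) (F (u j.+1) - F (u j)) = F (u n) - F (u 0%N).
  by rewrite (telescope_sumr (fun j => F (u j))).
have m0 : 0 <= F (u 0%N) by exact: cumul_ge0.
have m1 : F (u n) <= mass p k by exact: cumul_le_mass.
have t2 : 0 <= 2 / t by rewrite divr_ge0 // ltW.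
rewrite EE !ler_norml => /andP[h1 h2].
by apply/andP; split; lra.
Qed.

(** The total mass is approximated as well as the partial sums, so normalizing the
    weights preserves the rate. *)
Theorem lattice_cdf B : 0 < B -> exists2 K, 0 < K &
  forall t d (u0 : R) n a, 0 < t -> 0 <= d <= 2 -> d * t <= 2 ->
  (forall j, 0 <= a j) ->
  (forall j, (j < n)%N ->
    `|a j - expow p k (u0 + d * j%:R)| <= B / (t * (1 + (u0 + d * j%:R) ^+ 2))) ->
  u0 <= 1 -> t <= B * (1 + `|u0|) ->
  0 <= u0 + d * n%:R -> t <= B * (1 + `|u0 + d * n%:R|) ->
  forall z, `|(\sum_(0 <= j < n | u0 + d * j%:R <= z) a j) / (\sum_(0 <= j < n) a j)
              - cumul p k z / mass p k| <= K / t.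
Proof.
move=> B0; have [E E0 H] := lattice_sum_cumul B0.
have T0 := mass_gt0 p1 k0; move: (mass p k) T0 H => T T0 H.
exists (2 * E / T); first by rewrite divr_gt0 // mulr_gt0.
move=> t d u0 n a t0 d02 dt a0 ha u01 tu0 un0 tun z.
have [/(_ z) hz hT] := H t d u0 n a t0 d02 dt ha u01 tu0 un0 tun.
have [d0 d2] := andP d02.
move: hz hT; set S := \sum_(0 <= j < n) a j; set Sz := \sum_(0 <= j < n | _) a j.
move=> hz hT.
have Sz0 : 0 <= Sz by apply: sumr_ge0 => j _; exact: a0.
have SzS : Sz <= S.
  rewrite /Sz big_mkcond; apply: ler_sum => j _; by case: ifP.
have Et : 0 <= E / t by rewrite divr_ge0 // ltW.
have -> : 2 * E / T / t = (E / t + E / t) / T by field; rewrite !gt_eqF.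
rewrite ler_pdivlMr // -[X in _ * X](gtr0_norm T0) -normrM mulrBl divfK ?gt_eqF //.
have [S0|S0] := eqVneq S 0.
  have Sz00 : Sz = 0 by apply/eqP; rewrite eq_le Sz0 -S0 SzS.
  rewrite S0 invr0 mulr0 mul0r; move: hz; rewrite Sz00 mulr0; lra.
have Sp : 0 < S by rewrite lt0r S0 (le_trans Sz0 SzS).
have -> : Sz / S * T - cumul p k z = (d * Sz - cumul p k z) - Sz / S * (d * S - T).
  by field.
apply: le_trans (ler_normB _ _) _; rewrite lerD // normrM.
rewrite -[leRHS]mul1r ler_pM // ger0_norm ?divr_ge0 ?(ltW Sp) //.
by rewrite ler_pdivrMr // mul1r.
Qed.

End LatticeCdf.

(** * Local limit estimate for the weights *)

Section Gap.
Variable R : realType.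
Implicit Types (J h x m c : R).

Lemma ptilde_gap_segment J h m a b : unique_maximizer J h m ->
  0 <= a -> b <= 1 -> ~~ (a <= m <= b) ->
  exists2 c : R, 0 < c & forall x, a <= x <= b -> ptilde J h x <= ptilde J h m - c.
Proof.
move=> um a0 b1 mab; have [ab|ba] := leP a b; last first.
  exists 1 => // x /andP[ax xb]; move: (le_lt_trans (le_trans ax xb) ba).
  by rewrite ltxx.
have [|y] := @EVT_max R (ptilde J h) a b ab.
  apply: derivable_within_continuous => x _.
  by have [] := has_derive_ptilde J h x.
rewrite in_itv /= => yab ymax.
have mm : maximizers J h m by rewrite um.
exists (ptilde J h m - ptilde J h y); last first.
  by move=> x xab; rewrite opprB addrC subrK ymax // in_itv.
rewrite subr_gt0 ltNge; apply/negP => le; move/negP: mab; apply.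
suff -> : m = y by [].
suff : maximizers J h y by rewrite um.
case: mm => _ mmax; split.
  by have /andP[ay yb] := yab; rewrite in_itv /= (le_trans a0 ay) (le_trans yb b1).
by move=> x x01; apply: le_trans le; exact: mmax.
Qed.

(** Compactness gives the gap for [ptilde], which is continuous on the whole line;
    the rate function inherits it, being smaller and equal at [m]. *)
Lemma rate_gap J h m e : 0 < J -> unique_maximizer J h m -> 0 < e ->
  exists2 c : R, 0 < c & forall x, 0 <= x <= 1 -> e <= `|x - m| ->
    rate J h x <= rate J h m - c.
Proof.
move=> J0 um e0.
have mx : maximizers J h m by rewrite um.
have [||c1 c10 h1] := @ptilde_gap_segment J h m 0 (m - e) um (lexx _).
- have /andP[_] := maximizer_itv J0 mx; lra.
- by apply/negP => /andP[_]; lra.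
have [||c2 c20 h2] := @ptilde_gap_segment J h m (m + e) 1 um _ (lexx _).
- have /andP[] := maximizer_itv J0 mx; lra.
- by apply/negP => /andP[]; lra.
exists (Num.min c1 c2); first by rewrite lt_min c10 c20.
move=> x x01 xm; rewrite (rate_maximizer J0 mx).
apply: le_trans (rate_le_ptilde J h x01) _.
have [xm'|xm'] := leP m x.
  apply: le_trans (h2 x _) _; last by rewrite lerD2l lerN2 ge_min lexx orbT.
  by move: xm x01; rewrite ger0_norm ?subr_ge0 // => ? /andP[? ?]; apply/andP; split; lra.
apply: le_trans (h1 x _) _; last by rewrite lerD2l lerN2 ge_min lexx.
by move: xm x01; rewrite ltr0_norm ?subr_lt0 // => ? /andP[? ?]; apply/andP; split; lra.
Qed.

End Gap.

Section LocalLimit.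
Variables (R : realType) (r : nat) (kap m : R) (f : R -> R).
Hypotheses (r0 : (0 < r)%N) (kap0 : 0 < kap) (m0 : 0 < m) (m1 : m < 1).
Local Notation p := r.+1.
Local Notation s := (stirling_defect R).

Hypothesis taylor : exists2 C : R, 0 < C & exists2 eps : R, 0 < eps &
  forall e, `|e| <= eps -> `|f (m + e) - f m + kap * `|e| ^+ p| <= C * `|e| ^+ p.+1.
Hypothesis gap : forall e : R, 0 < e -> exists2 c : R, 0 < c &
  forall x, 0 <= x <= 1 -> e <= `|x - m| -> f x <= f m - c.

(** Adding [1] keeps the reference points positive, where the defects are
    Lipschitz, for every [N]. *)
Definition ref_monomers N : nat := (Num.truncn (N%:R * m)).+1.
Definition ref_dimers N : nat := (Num.truncn (N%:R * (1 - m) / 2)).+1.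

(** The Gibbs weight of [n] monomers and [k] dimers relative to its value at
    density [m], the factorial corrections being frozen at integer reference
    points. *)
Definition rel_weight N n k : R :=
  expR (N%:R * (f (n%:R / N%:R) - f m)
        - (s k - s (ref_dimers N)) - (s n - s (ref_monomers N))).

Lemma truncnS_bounds (x : R) : 0 <= x ->
  x <= (Num.truncn x).+1%:R /\ `|x - (Num.truncn x).+1%:R| <= 1.
Proof.
move=> x0; have /andP[h1 h2] := truncn_itv x0; rewrite ltW //; split=> //.
by rewrite ltr0_norm ?subr_lt0 //; have := @natr1 R (Num.truncn x); lra.
Qed.

Section FixedSize.
Variables (N n k : nat) (t : R).
Hypotheses (N0 : (0 < N)%N) (kn : (k * 2 + n = N)%N) (t0 : 0 < t) (tN : t ^+ p = N%:R).
Let u : R := (n%:R - N%:R * m) / t ^+ r.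
Let e : R := n%:R / N%:R - m.

Let NR : 0 < N%:R :> R. Proof. by rewrite ltr0n. Qed.

Let t1 : 1 <= t.
Proof.
rewrite leNgt; apply/negP => t_lt1.
have : t ^+ p < 1 by rewrite exprn_ilt1 // ltW.
by rewrite tN ltNge ler1n N0.
Qed.

Let tr0 : 0 < t ^+ r. Proof. by rewrite exprn_gt0. Qed.

Let eE : e = u / t.
Proof.
rewrite /e /u -tN exprS; field; rewrite !gt_eqF //.
Qed.

Let ue : u = e * t. Proof. by rewrite eE divfK // gt_eqF. Qed.

Let tleN : t <= N%:R. Proof. by rewrite -tN -[leLHS]expr1 ler_weXn2l. Qed.

Let nE : n%:R = N%:R * (m + e).
Proof. by rewrite /e addrC subrK mulrC divfK // gt_eqF. Qed.

Let kE : k%:R = N%:R * (1 - (m + e)) / 2.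
Proof. by have := congr1 (fun i => i%:R : R) kn; rewrite natrD natrM nE => h; lra. Qed.

Let xE : n%:R / N%:R = m + e.
Proof. by rewrite nE mulrC mulKf // gt_eqF. Qed.

Let x01 : 0 <= m + e <= 1.
Proof.
by rewrite -xE divr_ge0 //= ler_pdivrMr // mul1r ler_nat -kn leq_addl.
Qed.

Let e_le1 : `|e| <= 1.
Proof.
have := x01; move: e => e' /andP[h1 h2].
by have := m0; have := m1; rewrite ler_norml => ? ?; apply/andP; split; lra.
Qed.

Let N_main (C eps : R) : 0 < C -> `|e| <= eps ->
  `|f (m + e) - f m + kap * `|e| ^+ p| <= C * `|e| ^+ p.+1 ->
  `|N%:R * (f (m + e) - f m) + kap * `|u| ^+ p| <= C * `|u| ^+ p.+1 / t /\
  `|N%:R * (f (m + e) - f m) + kap * `|u| ^+ p| <= C * eps * `|u| ^+ p.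
Proof.
move=> C0 ee H.
have uN : `|u| ^+ p = N%:R * `|e| ^+ p.
  by rewrite ue normrM (gtr0_norm t0) exprMn tN mulrC.
have -> : N%:R * (f (m + e) - f m) + kap * `|u| ^+ p =
  N%:R * (f (m + e) - f m + kap * `|e| ^+ p) by rewrite uN; ring.
rewrite normrM (gtr0_norm NR).
have {}H := ler_wpM2l (ltW NR) H.
have eq1 : N%:R * (C * `|e| ^+ p.+1) = C * `|e| * `|u| ^+ p by rewrite uN exprS; ring.
split; apply: (le_trans H); rewrite eq1.
  rewrite [in leRHS]exprS.
  have -> : `|e| = `|u| / t by rewrite eE normrM normfV (gtr0_norm t0).
  by rewrite le_eqVlt; apply/orP; left; apply/eqP; ring.
by rewrite ler_wpM2r ?exprn_ge0 // ler_wpM2l ?(ltW C0).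
Qed.

Let corr_n : `|e| <= m / 2 ->
  `|s n - s (ref_monomers N)| <= 2 / m * ((1 + `|u|) / t) /\
  `|s n - s (ref_monomers N)| <= 4 / m.
Proof.
move=> em; have [b1 b2] := @truncnS_bounds (N%:R * m) (mulr_ge0 (ltW NR) (ltW m0)).
rewrite -/(ref_monomers N) in b1 b2.
have c0 : 0 < N%:R * (m / 2) by rewrite mulr_gt0 // divr_gt0.
have h1 : N%:R * (m / 2) <= n%:R.
  by rewrite nE ler_pM2l //; move: em; rewrite ler_norml => /andP[]; have := m0; lra.
have h2 : N%:R * (m / 2) <= (ref_monomers N)%:R.
  by apply: le_trans b1; rewrite ler_pM2l //; have := m0; lra.
have h := stirling_defect_lip c0 h1 h2.
have d : `|n%:R - (ref_monomers N)%:R| <= N%:R * `|e| + 1.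
  have -> : n%:R - (ref_monomers N)%:R = N%:R * e + (N%:R * m - (ref_monomers N)%:R) :> R.
    by rewrite nE; ring.
  by apply: le_trans (ler_normD _ _) _; rewrite normrM (gtr0_norm NR) lerD2l.
have V0 : 0 <= (N%:R * (m / 2))^-1 by rewrite invr_ge0 ltW.
have {}h := le_trans h (ler_wpM2r V0 d).
have eq1 : (N%:R * `|e| + 1) / (N%:R * (m / 2)) = 2 / m * (`|e| + N%:R^-1).
  by field; rewrite !gt_eqF.
have Nt : N%:R^-1 <= t^-1 by rewrite lef_pV2 ?posrE.
have N1 : N%:R^-1 <= 1 :> R by rewrite invf_le1 // ler1n.
have ut : `|e| = `|u| / t by rewrite eE normrM normfV (gtr0_norm t0).
have m20 : 0 <= 2 / m by rewrite divr_ge0 // ltW.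
rewrite eq1 in h; split; apply: (le_trans h).
  by rewrite ler_wpM2l // ut mulrDl mul1r addrC lerD2r.
by rewrite (_ : 4 / m = 2 / m * 2) ?ler_wpM2l //;
  [have := e_le1; lra|field; rewrite gt_eqF].
Qed.

Let corr_k : `|e| <= (1 - m) / 2 ->
  `|s k - s (ref_dimers N)| <= 4 / (1 - m) * ((1 + `|u|) / t) /\
  `|s k - s (ref_dimers N)| <= 8 / (1 - m).
Proof.
have m1' : 0 < 1 - m by rewrite subr_gt0.
move=> em; have [|b1 b2] := @truncnS_bounds (N%:R * (1 - m) / 2).
  by rewrite divr_ge0 // mulr_ge0 // ltW.
rewrite -/(ref_dimers N) in b1 b2.
have c0 : 0 < N%:R * ((1 - m) / 4) by rewrite mulr_gt0 // divr_gt0.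
have h1 : N%:R * ((1 - m) / 4) <= k%:R.
  by rewrite kE -mulrA ler_pM2l //; move: em; rewrite ler_norml => /andP[]; have := m1; lra.
have h2 : N%:R * ((1 - m) / 4) <= (ref_dimers N)%:R.
  by apply: le_trans b1; rewrite -mulrA ler_pM2l //; have := m1; lra.
have h := stirling_defect_lip c0 h1 h2.
have d : `|k%:R - (ref_dimers N)%:R| <= N%:R * `|e| + 1.
  have -> : k%:R - (ref_dimers N)%:R =
     - (N%:R * e / 2) + (N%:R * (1 - m) / 2 - (ref_dimers N)%:R) :> R.
    by rewrite kE; field.
  apply: le_trans (ler_normD _ _) _; rewrite normrN -mulrA normrM (gtr0_norm NR) lerD //.
  rewrite ler_wpM2l ?(ltW NR) // normrM (@gtr0_norm _ 2^-1) //.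
  by have := normr_ge0 e; lra.
have V0 : 0 <= (N%:R * ((1 - m) / 4))^-1 by rewrite invr_ge0 ltW.
have {}h := le_trans h (ler_wpM2r V0 d).
have eq1 : (N%:R * `|e| + 1) / (N%:R * ((1 - m) / 4)) = 4 / (1 - m) * (`|e| + N%:R^-1).
  by field; rewrite !gt_eqF.
have Nt : N%:R^-1 <= t^-1 by rewrite lef_pV2 ?posrE.
have N1 : N%:R^-1 <= 1 :> R by rewrite invf_le1 // ler1n.
have ut : `|e| = `|u| / t by rewrite eE normrM normfV (gtr0_norm t0).
have m20 : 0 <= 4 / (1 - m) by rewrite divr_ge0 // ltW.
rewrite eq1 in h; split; apply: (le_trans h).
  by rewrite ler_wpM2l // ut mulrDl mul1r addrC lerD2r.
by rewrite (_ : 8 / (1 - m) = 4 / (1 - m) * 2) ?ler_wpM2l //;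
  [have := e_le1; lra|field; rewrite gt_eqF].
Qed.

(** The exponent differs from [- kap * `|u| ^+ p] by at most a multiple of
    [(1 + `|u|) ^+ p.+1 / t], and also by at most half of [kap * `|u| ^+ p] plus a
    constant, so that half of the decay is left to absorb the powers of [u]. *)
Lemma rel_weight_near (C eps : R) (c := 2 / m + 4 / (1 - m)) :
  0 < C -> `|e| <= eps -> eps <= m / 2 -> eps <= (1 - m) / 2 -> C * eps <= kap / 2 ->
  `|f (m + e) - f m + kap * `|e| ^+ p| <= C * `|e| ^+ p.+1 ->
  `|rel_weight N n k - expow p kap u| <=
    (C + c) * ((1 + `|u|) ^+ p.+1 / t) * (2 * expR (2 * c) * expow p (kap / 2) u).
Proof.
move=> C0 ee em em' Ck T.
have [a1 a2] := N_main C0 ee T.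
have [b1 b2] := corr_n (le_trans ee em).
have [d1 d2] := corr_k (le_trans ee em').
have c0 : 0 < c by rewrite addr_gt0 // divr_gt0 // subr_gt0.
have c2 : 4 / m + 8 / (1 - m) = 2 * c by rewrite /c; field; rewrite !gt_eqF // subr_gt0.
rewrite /rel_weight xE.
move: a1 a2 b1 b2 d1 d2; set M := N%:R * _; set A := kap * `|u| ^+ p.
set dn := s n - _; set dk := s k - _ => a1 a2 b1 b2 d1 d2.
have u0 : 0 <= `|u| by exact: normr_ge0.
have up0 : 0 <= `|u| ^+ p by rewrite exprn_ge0.
have tV : 0 <= t^-1 by rewrite invr_ge0 ltW.
have D1 : `|M + A - dk - dn| <= (C + c) * ((1 + `|u|) ^+ p.+1 / t).
  have h1 : C * `|u| ^+ p.+1 / t <= C * ((1 + `|u|) ^+ p.+1 / t).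
    rewrite -mulrA ler_wpM2l ?(ltW C0) // ler_wpM2r //.
    by rewrite lerXn2r ?nnegrE ?addr_ge0 // lerDr.
  have h2 : c * ((1 + `|u|) / t) <= c * ((1 + `|u|) ^+ p.+1 / t).
    by rewrite ler_wpM2l ?(ltW c0) // ler_wpM2r // -[leLHS]expr1 ler_weXn2l // lerDl.
  have h3 : `|M + A - dk - dn| <= `|M + A| + `|dk| + `|dn|.
    by apply: le_trans (ler_normB _ _) _; rewrite lerD2r; exact: ler_normB.
  apply: (le_trans h3); rewrite [leRHS]mulrDl; apply: le_trans (lerD h1 h2).
  have -> : c * ((1 + `|u|) / t) = 2 / m * ((1 + `|u|) / t) + 4 / (1 - m) * ((1 + `|u|) / t).
    by rewrite -mulrDl.
  by rewrite -addrA (addrC `|dk|) lerD // lerD.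
have D2 : M + A - dk - dn <= kap / 2 * `|u| ^+ p + 2 * c.
  have := ler_norm (M + A); have := ler_norm (- dk); have := ler_norm (- dn).
  rewrite !normrN -c2 => h1 h2 h3.
  have : C * eps * `|u| ^+ p <= kap / 2 * `|u| ^+ p by rewrite ler_wpM2r.
  by lra.
have -> : M - dk - dn = - A + (M + A - dk - dn) by ring.
move: D1 D2; set D := M + A - dk - dn => D1 D2.
have := expR_lip (- A + D) (- A).
rewrite addrAC subrr add0r -/(expow p kap u) => h; apply: (le_trans h).
have E0 : 0 < expow p (kap / 2) u by exact: expow_gt0.
have k2 : A = kap / 2 * `|u| ^+ p + kap / 2 * `|u| ^+ p by rewrite /A; field.
have k20 : 0 <= kap / 2 * `|u| ^+ p by rewrite mulr_ge0 // divr_ge0 // ltW.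
apply: ler_pM => //; first by rewrite addr_ge0 // ltW ?expR_gt0.
rewrite [2 * _ * _](_ : _ = expR (2 * c) * expow p (kap / 2) u
  + expR (2 * c) * expow p (kap / 2) u); last by ring.
rewrite -expRD; apply: lerD; rewrite ler_expR; first by lra.
by rewrite -/A; lra.
Qed.

Let p2 : (2 <= p)%N. Proof. by rewrite ltnS. Qed.

Let stirling_ref i : (0 < i)%N -> i%:R <= 2 * N%:R :> R -> s i <= 1 + ln (2 * N%:R).
Proof.
move=> i0 iN; apply: le_trans (stirling_defect_le _ i0) _.
by rewrite lerD2l ler_ln ?posrE ?ltr0n // mulr_gt0.
Qed.

(** The decay [expR (- (c * N%:R))] given by the gap outweighs the defects at the
    reference points, which are only logarithmic in [N]. *)
Lemma rel_weight_far (c eps : R) : 0 < c -> eps <= `|e| -> f (m + e) <= f m - c ->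
  [/\ rel_weight N n k <= 4 * expR 2 * (t ^+ (p + p) * expR (- (c * t ^+ 2))),
      eps * t <= `|u| & `|u| <= t].
Proof.
move=> c0 ee fe; split; last 2 first.
- by rewrite ue normrM (gtr0_norm t0) ler_pM2r.
- by rewrite ue normrM (gtr0_norm t0) ler_piMl // ltW.
have N1 : 1 <= N%:R :> R by rewrite ler1n.
have h1 : s (ref_monomers N) <= 1 + ln (2 * N%:R).
  apply: stirling_ref => //.
  have [|_] := @truncnS_bounds (N%:R * m); first by rewrite mulr_ge0 // ltW.
  rewrite -/(ref_monomers N) ler_norml => /andP[h _].
  have : N%:R * m <= N%:R by rewrite ler_piMr // ltW.
  by lra.
have h2 : s (ref_dimers N) <= 1 + ln (2 * N%:R).
  have m1' : 0 < 1 - m by rewrite subr_gt0.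
  apply: stirling_ref => //.
  have [|_] := @truncnS_bounds (N%:R * (1 - m) / 2).
    by rewrite divr_ge0 // mulr_ge0 // ltW.
  rewrite -/(ref_dimers N) ler_norml => /andP[h _].
  have : N%:R * (1 - m) <= N%:R by rewrite ler_piMr // gerBl ltW.
  have := ltW NR; lra.
have h3 := stirling_defect_ge0 R n; have h4 := stirling_defect_ge0 R k.
have h5 := ler_wpM2l (ltW NR) fe.
have h6 : c * t ^+ 2 <= c * N%:R.
  by rewrite ler_pM2l // -tN ler_weXn2l.
have -> : 4 * expR 2 * (t ^+ (p + p) * expR (- (c * t ^+ 2))) =
  expR (2 + (ln (2 * N%:R) + ln (2 * N%:R)) - c * t ^+ 2).
  rewrite !expRD lnK ?posrE ?mulr_gt0 // exprD tN; ring.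
by rewrite ler_expR xE; lra.
Qed.

End FixedSize.

(** Near density [m] the Taylor expansion gives the limiting profile with an error
    of relative order [1 / t]; away from it the gap makes both sides tiny. *)
Lemma rel_weight_profile : exists2 B, 0 < B & forall N n k (t : R),
  (0 < N)%N -> (k * 2 + n = N)%N -> 0 < t -> t ^+ p = N%:R ->
  let u := (n%:R - N%:R * m) / t ^+ r in
  `|rel_weight N n k - expow p kap u| <= B / (t * (1 + u ^+ 2)).
Proof.
have [C C0 [eps0 eps00 T]] := taylor.
have m1' : 0 < 1 - m by rewrite subr_gt0.
(* Within eps of m the Taylor remainder is at most half of the main term, and
   both kinds of particles have positive density. *)
pose eps := Num.min (Num.min eps0 (kap / 2 / C)) (Num.min (m / 2) ((1 - m) / 2)).
have eps_gt0 : 0 < eps by rewrite !lt_min eps00 !divr_gt0.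
have [c c0 G] := gap eps_gt0.
pose c' : R := 2 / m + 4 / (1 - m).
have c'0 : 0 < c' by rewrite addr_gt0 // divr_gt0.
have p1 : (1 < p)%N by rewrite ltnS.
have k20 : 0 < kap / 2 by rewrite divr_gt0.
have [C8 C80 H8] := poly_expow_bounded (p.+1 + 2) p1 k20.
have [C9 C90 H9] := poly_gauss_bounded (p + p + 3) c0.
have [C10 C100 H10] := poly_expow_bounded 3 p1 kap0.
(* B1 serves near m; far from m, B2 bounds the weights and B3 the profile. *)
pose B1 := (C + c') * (2 * expR (2 * c')) * C8.
pose B2 := 2 * (4 * expR 2) * C9.
pose B3 := C10 / eps.
have W0 : 0 < (C + c') * (2 * expR (2 * c')).
  by apply: mulr_gt0; [exact: addr_gt0|apply: mulr_gt0 => //; exact: expR_gt0].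
have B10 : 0 < B1 by rewrite mulr_gt0.
have B20 : 0 < B2 by rewrite mulr_gt0 // mulr_gt0 // mulr_gt0.
have B30 : 0 < B3 by rewrite divr_gt0.
exists (B1 + B2 + B3); first by rewrite !addr_gt0.
move=> N n k t N0 kn t0 tN; set u : R := _ / t ^+ r; rewrite /=.
have t1 : 1 <= t.
  rewrite leNgt; apply/negP => t_lt1.
  have : t ^+ p < 1 by rewrite exprn_ilt1 // ltW.
  by rewrite tN ltNge ler1n N0.
pose e : R := n%:R / N%:R - m.
have u2 : 0 < 1 + u ^+ 2 by rewrite ltr_pwDl ?sqr_ge0.
have uu : 1 + u ^+ 2 <= (1 + `|u|) ^+ 2.
  by rewrite -real_normK ?num_real // sqrrD; have := normr_ge0 u; lra.
have u0 := normr_ge0 u.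
rewrite ler_pdivlMr ?mulr_gt0 //.
have [ee|ee] := leP `|e| eps.
  have ee0 : `|e| <= eps0 by apply: le_trans ee _; rewrite !ge_min lexx.
  have Ck : C * eps <= kap / 2.
    by rewrite mulrC -ler_pdivlMr // !ge_min lexx orbT.
  have em : eps <= m / 2 by rewrite !ge_min lexx !orbT.
  have em' : eps <= (1 - m) / 2 by rewrite !ge_min lexx !orbT.
  have h := rel_weight_near N0 kn t0 tN C0 ee em em' Ck (T e ee0).
  apply: (@le_trans _ _ B1); last by lra.
  rewrite -/c' -/u in h.
  apply: le_trans (ler_wpM2r _ h) _; first by rewrite ltW // mulr_gt0.
  have E0 : 0 <= expow p (kap / 2) u by rewrite ltW ?expow_gt0.
  rewrite [leLHS](_ : _ = (C + c') * (2 * expR (2 * c')) *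
      ((1 + `|u|) ^+ p.+1 * expow p (kap / 2) u * (1 + u ^+ 2))); last first.
    by field; rewrite gt_eqF.
  rewrite ler_wpM2l ?(ltW W0) //; apply: le_trans (H8 u).
  by rewrite mulrAC exprD ler_wpM2r // ler_wpM2l // exprn_ge0 // addr_ge0.
have x01 : 0 <= m + e <= 1.
  rewrite /e addrC subrK divr_ge0 //= ler_pdivrMr ?ltr0n // mul1r ler_nat.
  by rewrite -kn leq_addl.
have fe : f (m + e) <= f m - c.
  by apply: G => //; rewrite addrAC subrr add0r ltW.
have [h1 h2 h3] := rel_weight_far N0 kn t0 tN c0 (ltW ee) fe.
rewrite -/u in h2 h3.
apply: (@le_trans _ _ (B2 + B3)); last by lra.
have tu0 : 0 <= t * (1 + u ^+ 2) by rewrite ltW // mulr_gt0.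
have w0 : 0 < rel_weight N n k by exact: expR_gt0.
have q0 : 0 < expow p kap u by exact: expow_gt0.
apply: le_trans (ler_wpM2r tu0 (ler_normB _ _)) _.
rewrite (gtr0_norm w0) (gtr0_norm q0) mulrDl lerD //.
  apply: (@le_trans _ _
    (4 * expR 2 * (t ^+ (p + p) * expR (- (c * t ^+ 2))) * (t * (2 * t ^+ 2)))).
    apply: ler_pM => //; first exact: ltW.
    rewrite ler_pM2l // -real_normK ?num_real //.
    have : `|u| ^+ 2 <= t ^+ 2 by rewrite lerXn2r ?nnegrE // ltW.
    have : 1 <= t ^+ 2 by rewrite exprn_ege1.
    by lra.
  rewrite [leLHS](_ : _ = 2 * (4 * expR 2) * (t ^+ (p + p + 3) * expR (- (c * t ^+ 2))));
    last by rewrite !exprD; ring.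
  rewrite ler_wpM2l ?mulr_ge0 ?expR_ge0 //; apply: le_trans (H9 t (ltW t0)).
  rewrite ler_wpM2r ?expR_ge0 // lerXn2r ?nnegrE ?addr_ge0 ?(ltW t0) //.
  by rewrite lerDr.
rewrite ler_pdivlMr //; apply: le_trans (H10 u).
rewrite [leLHS](_ : _ = eps * t * (1 + u ^+ 2) * expow p kap u); last by ring.
rewrite ler_wpM2r ?(ltW q0) // exprS ler_pM ?mulr_ge0 ?(ltW u2) ?(ltW eps_gt0) ?(ltW t0) //.
by apply: (le_trans h2); rewrite lerDr.
Qed.

End LocalLimit.

(** The number of monomers has the parity of [N]; index [j] corresponds to
    [N./2 - j] dimers. *)
Definition lattice_monomers N j : nat := (odd N + j * 2)%N.

Lemma lattice_monomersK N j : (j < N./2.+1)%N ->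
  ((N./2 - j) * 2 + lattice_monomers N j = N)%N.
Proof.
rewrite ltnS /lattice_monomers => jN; have := odd_double_half N; rewrite -muln2; lia.
Qed.

Lemma lattice_monomers_last N : lattice_monomers N N./2.+1 = N.+2.
Proof.
by rewrite /lattice_monomers; have := odd_double_half N; rewrite -muln2; lia.
Qed.

Section RelWeightCdf.
Variables (R : realType) (r : nat) (kap m : R) (f : R -> R).
Hypotheses (r0 : (0 < r)%N) (kap0 : 0 < kap) (m0 : 0 < m) (m1 : m < 1).
Local Notation p := r.+1.

Hypothesis taylor : exists2 C : R, 0 < C & exists2 eps : R, 0 < eps &
  forall e, `|e| <= eps -> `|f (m + e) - f m + kap * `|e| ^+ p| <= C * `|e| ^+ p.+1.
Hypothesis gap : forall e : R, 0 < e -> exists2 c : R, 0 < c &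
  forall x, 0 <= x <= 1 -> e <= `|x - m| -> f x <= f m - c.

Definition lattice_weight N j : R :=
  rel_weight m f N (lattice_monomers N j) (N./2 - j).

(** The rescaled lattice has step [2 / t ^+ r], at most [2 / t] since [0 < r], and
    runs from about [- m * t] to about [(1 - m) * t]. *)
Theorem rel_weight_cdf : exists2 K, 0 < K & forall N (t : R),
  (0 < N)%N -> 0 < t -> t ^+ p = N%:R -> forall z,
  `|(\sum_(0 <= j < N./2.+1 | ((lattice_monomers N j)%:R - N%:R * m) / t ^+ r <= z)
       lattice_weight N j) / (\sum_(0 <= j < N./2.+1) lattice_weight N j)
    - cumul p kap z / mass p kap| <= K / t.
Proof.
have [B B0 H] := rel_weight_profile r0 kap0 m0 m1 taylor gap.
have m1' : 0 < 1 - m by rewrite subr_gt0.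
have p1 : (1 < p)%N by rewrite ltnS.
pose B' := B + m^-1 + (1 - m)^-1.
have B'0 : 0 < B' by rewrite !addr_gt0 // invr_gt0.
have [K K0 HK] := lattice_cdf p1 kap0 B'0.
exists K => // N t N0 t0 tN z; set w := lattice_weight N.
have t1 : 1 <= t.
  rewrite leNgt; apply/negP => t_lt1.
  have : t ^+ p < 1 by rewrite exprn_ilt1 // ltW.
  by rewrite tN ltNge ler1n N0.
have tr0 : 0 < t ^+ r by rewrite exprn_gt0.
have tr : t <= t ^+ r by rewrite -[leLHS]expr1 ler_weXn2l.
have tr1 : 1 <= t ^+ r := le_trans t1 tr.
pose d := 2 / t ^+ r.
pose u0 := ((odd N)%:R - N%:R * m) / t ^+ r.
have uE j : u0 + d * j%:R = ((lattice_monomers N j)%:R - N%:R * m) / t ^+ r.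
  by rewrite /u0 /d /lattice_monomers natrD natrM; field; rewrite gt_eqF.
have NE : N%:R = t * t ^+ r by rewrite -tN exprS.
have lastE : u0 + d * N./2.+1%:R = (N%:R + 2 - N%:R * m) / t ^+ r.
  rewrite uE; congr ((_ - _) / _).
  by rewrite lattice_monomers_last -addn2 natrD.
have u0le : u0 <= 1 - m * t.
  rewrite /u0 mulrBl lerB //.
    rewrite ler_pdivrMr // mul1r; apply: le_trans tr1.
    by case: (odd N).
  by rewrite NE mulrAC mulfK ?gt_eqF // mulrC.
have unge : (1 - m) * t <= u0 + d * N./2.+1%:R.
  rewrite lastE ler_pdivlMr // -mulrA -NE; lra.
have mt : 0 < m * t by rewrite mulr_gt0.
have mt' : 0 < (1 - m) * t by rewrite mulr_gt0.
have inv1 : 0 < m^-1 by rewrite invr_gt0.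
have inv2 : 0 < (1 - m)^-1 by rewrite invr_gt0.
have -> : \sum_(0 <= j < N./2.+1 | ((lattice_monomers N j)%:R - N%:R * m) / t ^+ r <= z) w j
  = \sum_(0 <= j < N./2.+1 | u0 + d * j%:R <= z) w j.
  by apply: eq_bigl => j; rewrite uE.
apply: (HK t d u0 N./2.+1 w) => //.
- rewrite divr_ge0 ?(ltW tr0) //= ler_pdivrMr // -[leLHS]mulr1 ler_pM2l //.
- rewrite /d mulrAC ler_pdivrMr // ler_pM2l //.
- by move=> j; rewrite ltW ?expR_gt0.
- move=> j jN; have := H N _ _ t N0 (lattice_monomersK jN) t0 tN => /= h.
  rewrite uE; apply: (le_trans h); rewrite ler_wpM2r //; last by rewrite /B'; lra.
  by rewrite invr_ge0 mulr_ge0 ?(ltW t0) // addr_ge0 ?sqr_ge0.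
- lra.
- apply: (@le_trans _ _ (m^-1 * (m * t))); first by rewrite mulKf // gt_eqF.
  apply: ler_pM; [exact: ltW|exact: ltW|by rewrite /B'; lra|].
  by have := ler_norm (- u0); rewrite normrN; lra.
- by apply: le_trans unge; rewrite ltW.
- apply: (@le_trans _ _ ((1 - m)^-1 * ((1 - m) * t))); first by rewrite mulKf // gt_eqF.
  apply: ler_pM; [exact: ltW|exact: ltW|by rewrite /B'; lra|].
  by have := ler_norm (u0 + d * N./2.+1%:R); lra.
Qed.

End RelWeightCdf.

(** * The distribution of the number of monomers *)

Section MonomerCdf.
Variable R : realType.
Implicit Types (J h m z c : R) (N : nat).

Lemma sum_dimers_by_size N (P : pred nat) (phi : nat -> R) :
  \sum_(D : {set {set 'I_N}} | is_dimer D && P #|monomers D|) phi #|monomers D| =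
  \sum_(0 <= j < N./2.+1 | P (lattice_monomers N j))
    #|dimers_of_size N (N./2 - j)%N|%:R * phi (lattice_monomers N j).
Proof.
have sz (D : {set {set 'I_N}}) : is_dimer D -> (#|D| < N./2.+1)%N.
  by move/card_monomers; have := odd_double_half N; rewrite -muln2; lia.
have mon (D : {set {set 'I_N}}) : is_dimer D ->
    #|monomers D| = lattice_monomers N (N./2 - #|D|).
  move=> dD; have := card_monomers dD; have := sz D dD.
  by have := odd_double_half N; rewrite -muln2 /lattice_monomers; lia.
pose F k := \sum_(D in dimers_of_size N k | P (lattice_monomers N (N./2 - k)))
  phi (lattice_monomers N (N./2 - k)).
transitivity (\sum_(k < N./2.+1) F k).
  rewrite (partition_big (fun D : {set {set 'I_N}} => inord #|D| : 'I_(N./2.+1)) xpredT) //=.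
  apply: eq_bigr => k _; rewrite /F; apply: eq_big => [D|D /andP[/andP[dD _] /eqP <-]].
    rewrite inE; case dD: (is_dimer D) => //=.
    rewrite -(inj_eq val_inj) /= inordK ?sz // mon //.
    by rewrite andbC; case: eqP => [->|].
  by rewrite mon // inordK // sz.
rewrite -(big_mkord xpredT F) big_nat_rev /= [RHS]big_mkcond /=.
rewrite big_nat [RHS]big_nat; apply: eq_bigr => j /andP[_ jN].
rewrite add0n subSS /F subKn //.
case: (P _); last by rewrite big_pred0 // => D; rewrite andbF.
by under eq_bigl do rewrite andbT; rewrite sumr_const mulr_natl.
Qed.

(** The Gibbs weights are the relative weights up to a common factor, which cancels
    in the ratio. *)
Lemma monomer_cdf_lattice J h N m c z : (0 < N)%N ->
  monomer_cdf J h N m c z =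
  (\sum_(0 <= j < N./2.+1 | ((lattice_monomers N j)%:R - N%:R * m) / N%:R `^ c <= z)
     lattice_weight m (rate J h) N j)
  / (\sum_(0 <= j < N./2.+1)
     lattice_weight m (rate J h) N j).
Proof.
move=> N0; pose phi n := expR (N%:R * (J * (n%:R / N%:R) ^+ 2
  + (ln N%:R / 2 + h - J) * (n%:R / N%:R))) : R.
pose A : R := expR (log_scale R N + N%:R * rate J h m
  - stirling_defect R (ref_dimers m N) - stirling_defect R (ref_monomers m N)).
have A0 : A != 0 by rewrite gt_eqF ?expR_gt0.
have W j : (j < N./2.+1)%N ->
    #|dimers_of_size N (N./2 - j)%N|%:R * phi (lattice_monomers N j) =
    A * lattice_weight m (rate J h) N j.
  move=> jN; have kn := lattice_monomersK jN.
  have kN : ((N./2 - j) * 2 <= N)%N by rewrite -{2}kn leq_addr.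
  have nE : (N - (N./2 - j) * 2 = lattice_monomers N j)%N by rewrite -{1}kn addKn.
  have := card_dimers_of_size kN; rewrite nE => /(congr1 (fun i => i%:R : R)).
  rewrite natrM => cE.
  have -> : #|dimers_of_size N (N./2 - j)%N|%:R =
      N`!%:R / ((N./2 - j)`! * 2 ^ (N./2 - j) * (lattice_monomers N j)`!)%:R :> R.
    by rewrite -cE mulfK // gt_eqF // ltr0n !muln_gt0 !fact_gt0 expn_gt0.
  rewrite weight_as_rate // /A /lattice_weight /rel_weight -expRD; congr expR; ring.
have sumE (P : pred nat) :
    \sum_(D : {set {set 'I_N}} | is_dimer D && P #|monomers D|) expR (- hamiltonian J h D)
  = A * \sum_(0 <= j < N./2.+1 | P (lattice_monomers N j))
      lattice_weight m (rate J h) N j.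
  transitivity (\sum_(D : {set {set 'I_N}} | is_dimer D && P #|monomers D|)
    phi #|monomers D|).
    by apply: eq_bigr => D _; rewrite /hamiltonian opprK.
  rewrite mulr_sumr sum_dimers_by_size.
  rewrite big_mkcond [RHS]big_mkcond /= big_nat [RHS]big_nat.
  by apply: eq_bigr => j /andP[_ jN]; case: ifP => // _; exact: W.
rewrite /monomer_cdf /gibbs -mulr_suml /partition_function.
have := sumE (fun n => (n%:R - N%:R * m) / N%:R `^ c <= z); rewrite /= => ->.
have -> : \sum_(D : {set {set 'I_N}} | is_dimer D) expR (- hamiltonian J h D) =
  A * \sum_(0 <= j < N./2.+1) lattice_weight m (rate J h) N j.
  by rewrite -(sumE xpredT); apply: eq_bigl => D; rewrite andbT.
by rewrite -mulf_div mulfV // mul1r.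
Qed.

End MonomerCdf.

(** * Limit laws *)

Section LimitLaws.
Variable R : realType.
Implicit Types (J h m z v l : R) (N : nat).
Local Notation mu := (@lebesgue_measure R).

Lemma normal_cdf_cumul v z : 0 < v ->
  normal_cdf v z = cumul 2 (2 * v)^-1 z / mass 2 (2 * v)^-1.
Proof.
move=> v0; set k := (2 * v)^-1.
have k0 : 0 < k by rewrite invr_gt0 mulr_gt0.
have s0 : Num.sqrt v != 0 by rewrite sqrtr_eq0 -ltNge.
have pdfE x : normal_pdf 0 (Num.sqrt v) x = normal_peak (Num.sqrt v) * expow 2 k x.
  rewrite normal_pdfE // /normal_fun /expow subr0; congr (_ * expR _).
  rewrite sqr_sqrtr ?ltW // real_normK ?num_real // -mulr_natr /k.
  by field; rewrite gt_eqF.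
have int D : measurable D -> \int[mu]_(x in D) normal_pdf 0 (Num.sqrt v) x =
    normal_peak (Num.sqrt v) * \int[mu]_(x in D) expow 2 k x.
  move=> mD; rewrite -RintegralZl //; last exact: integrable_expow.
  by apply: eq_Rintegral => x _; rewrite pdfE.
have one : normal_peak (Num.sqrt v) * mass 2 k = 1.
  by rewrite /mass -int // /Rintegral integral_normal_pdf.
have T0 : mass 2 k != 0 by rewrite gt_eqF // mass_gt0.
rewrite /normal_cdf /normal_prob -/(Rintegral _ _ _) int // -/(cumul 2 k z).
by apply: (canRL (mulfK T0)); rewrite mulrAC one mul1r.
Qed.

Lemma quartic_cdf_cumul l z : 0 < l ->
  quartic_cdf l z = cumul 4 (l / 24) z / mass 4 (l / 24).
Proof.
move=> l0; have k0 : 0 < l / 24 by rewrite divr_gt0.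
have pE x : expR (- (l * x ^+ 4) / 24) = expow 4 (l / 24) x.
  rewrite /expow -normrX ger0_norm ?exprn_even_ge0 //.
  by congr expR; field.
have TE : quartic_normalizer l = (mass 4 (l / 24))^-1.
  rewrite /quartic_normalizer; congr (_^-1).
  by apply: eq_Rintegral => y _; rewrite pE.
rewrite /quartic_cdf /quartic_pdf TE /cumul [RHS]mulrC -RintegralZl //;
  last exact: integrable_expow.
by apply: eq_Rintegral => x _; rewrite pE.
Qed.

Lemma kolmogorov_dist_le (F G : R -> R) (c : R) :
  (forall z, `|F z - G z| <= c) -> (kolmogorov_dist F G <= c%:E)%E.
Proof. by move=> H; apply: ub_ereal_sup => _ [z _ <-]; rewrite lee_fin. Qed.

Lemma powR_root N (p i : nat) : (0 < p)%N ->
  (N%:R : R) `^ (i%:R / p%:R) = (N%:R `^ (1 / p%:R)) ^+ i.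
Proof.
move=> p0; rewrite -powR_mulrn ?powR_ge0 // -powRrM; congr (_ `^ _).
by field; rewrite pnatr_eq0 -lt0n.
Qed.

(** When the rate function is flat to order [r.+1] at its maximum, deviations of
    the density of order [N%:R `^ (- 1 / r.+1%:R)] have weights of order one; the
    remainder of order [r.+2] and the defects then both contribute errors of that
    same order. *)
Theorem monomer_cdf_rate r kap J h m : (0 < r)%N -> 0 < kap -> 0 < J ->
  unique_maximizer J h m ->
  (exists2 C : R, 0 < C & exists2 eps : R, 0 < eps & forall e : R, `|e| <= eps ->
    `|rate J h (m + e) - rate J h m + kap * `|e| ^+ r.+1| <= C * `|e| ^+ r.+2) ->
  exists K : R, forall N, (1 <= N)%N -> forall z,
    `|monomer_cdf J h N m (r%:R / r.+1%:R) z - cumul r.+1 kap z / mass r.+1 kap|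
      <= K / N%:R `^ (1 / r.+1%:R).
Proof.
move=> r0 kap0 J0 um T.
have mx : maximizers J h m by rewrite um.
have /andP[m0 m1] := maximizer_itv J0 mx.
have gap e : 0 < e -> exists2 c : R, 0 < c & forall x, 0 <= x <= 1 ->
    e <= `|x - m| -> rate J h x <= rate J h m - c by exact: rate_gap.
have [K _ H] := rel_weight_cdf r0 kap0 m0 m1 T gap.
exists K => N N0 z; have NR : 0 < N%:R :> R by rewrite ltr0n.
rewrite monomer_cdf_lattice // powR_root //; apply: H => //; first exact: powR_gt0.
by rewrite -powR_root // divff ?pnatr_eq0 // powRr1 // ltW.
Qed.

Lemma taylor_quadratic J h m : 0 < J -> maximizers J h m ->
  exists2 C : R, 0 < C & exists2 eps : R, 0 < eps & forall e : R, `|e| <= eps ->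
    `|rate J h (m + e) - rate J h m + quad J m * `|e| ^+ 2| <= C * `|e| ^+ 3.
Proof.
move=> J0 mx; have m01 := maximizer_itv J0 mx; have [m0 m1] := andP m01.
have [C C0 H] := rate_taylor m01 (maximizer_critical J0 mx).
exists (C + `|cub m| + `|quart m|); first by rewrite -addrA ltr_pwDl // addr_ge0.
exists (Num.min m (1 - m) / 2); first by rewrite divr_gt0 // lt_min m0 subr_gt0.
move=> e ee; have {}H := H e ee.
have e1 : `|e| <= 1.
  apply: le_trans ee _; rewrite ler_pdivrMr // mul1r ge_min; apply/orP; left; lra.
have e0 := normr_ge0 e.
rewrite real_normK ?num_real //.
set X := rate _ _ _ - _ + _ in H *.
have -> : X = (X - cub m * e ^+ 3 + quart m * e ^+ 4)
  + (cub m * e ^+ 3 - quart m * e ^+ 4) by ring.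
apply: le_trans (ler_normD _ _) _.
have h2 : `|cub m * e ^+ 3 - quart m * e ^+ 4| <=
    `|cub m| * `|e| ^+ 3 + `|quart m| * `|e| ^+ 4.
  by rewrite -!normrX -!normrM; exact: ler_normB.
have h3 : `|e| ^+ 4 <= `|e| ^+ 3 by rewrite [leLHS]exprS ler_piMl ?exprn_ge0.
have h5 : `|e| ^+ 5 <= `|e| ^+ 3.
  by apply: le_trans h3; rewrite [leLHS]exprS ler_piMl ?exprn_ge0.
have h6 := ler_wpM2l (normr_ge0 (quart m)) h3.
have h7 := ler_wpM2l (ltW C0) h5.
have -> : (C + `|cub m| + `|quart m|) * `|e| ^+ 3 =
  C * `|e| ^+ 3 + `|cub m| * `|e| ^+ 3 + `|quart m| * `|e| ^+ 3 by rewrite !mulrDl.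
lra.
Qed.

Lemma taylor_quartic h : 0 < Jc R -> maximizers (Jc R) h (mc R) ->
  exists2 C : R, 0 < C & exists2 eps : R, 0 < eps & forall e : R, `|e| <= eps ->
    `|rate (Jc R) h (mc R + e) - rate (Jc R) h (mc R) + quart (mc R) * `|e| ^+ 4|
      <= C * `|e| ^+ 5.
Proof.
move=> J0 mx; have m01 := maximizer_itv J0 mx; have [m0 m1] := andP m01.
have [C C0 H] := rate_taylor m01 (maximizer_critical J0 mx); exists C => //.
exists (Num.min (mc R) (1 - mc R) / 2).
  by rewrite divr_gt0 // lt_min m0 subr_gt0.
move=> e ee; have := H e ee.
have /eqP -> : quad (Jc R) (mc R) == 0 by rewrite quad_mc.
have /eqP -> : cub (mc R) == 0 by rewrite cub_eq0.
rewrite !mul0r subr0 addr0 -[`|e| ^+ 4]normrX.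
by rewrite (@ger0_norm _ (e ^+ 4)) // exprn_even_ge0.
Qed.

End LimitLaws.

Theorem theorem1 (R : realType) (gamma : R -> R)
    (hgamma : coexistence_curve gamma) (J h : R) (hJ : 0 < J) :
  (forall m0 : R,
     ~ (Gamma gamma `|` [set (Jc R, hc R)]) (J, h) ->
     unique_maximizer J h m0 ->
     let lambda := - (derive1n 2 (ptilde J h) m0)^-1 - (2 * J)^-1 in
     0 < lambda /\
     exists K : R, forall N : nat, (1 <= N)%N ->
       (kolmogorov_dist (monomer_cdf J h N m0 (1 / 2)) (normal_cdf lambda)
          <= (K / N%:R `^ (1 / 2))%:E)%E)
  /\
  (forall m0 : R,
     (J, h) = (Jc R, hc R) ->
     m0 = mc R ->
     unique_maximizer J h m0 ->
     let lambdac := - derive1n 4 (ptilde J h) (mc R) in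
     0 < lambdac /\
     exists K : R, forall N : nat, (1 <= N)%N ->
       (kolmogorov_dist (monomer_cdf J h N m0 (3 / 4)) (quartic_cdf lambdac)
          <= (K / N%:R `^ (1 / 4))%:E)%E).
Proof.
split=> m0.
  move=> ncrit um lambda.
  have mx : maximizers J h m0 by rewrite um.
  have q0 : 0 < quad J m0.
    by apply: (quad_gt0 hJ mx) => Jh; apply: ncrit; right; rewrite Jh.
  have lE : lambda = (2 * quad J m0)^-1 by exact: variance_quad hJ mx q0.
  have l0 : 0 < lambda by rewrite lE invr_gt0 mulr_gt0.
  split=> //.
  have [K H] := monomer_cdf_rate (ltn0Sn 0) q0 hJ um (taylor_quadratic hJ mx).
  exists K => N N1; apply: kolmogorov_dist_le => z.
  rewrite normal_cdf_cumul //.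
  have -> : (2 * lambda)^-1 = quad J m0 by rewrite lE; field; rewrite gt_eqF.
  exact: H.
move=> [JE hE] mE um lambdac; rewrite {}mE in um *.
have mx : maximizers J h (mc R) by rewrite um.
have m01 := maximizer_itv hJ mx.
have lE : lambdac = 24 * quart (mc R).
  by rewrite /lambdac; rewrite JE in mx *; exact: fourth_derivative_quart.
have q0 : 0 < quart (mc R) by exact: quart_gt0.
have l0 : 0 < lambdac by rewrite lE mulr_gt0.
split=> //.
have T : exists2 C : R, 0 < C & exists2 eps : R, 0 < eps & forall e : R, `|e| <= eps ->
    `|rate J h (mc R + e) - rate J h (mc R) + quart (mc R) * `|e| ^+ 4| <= C * `|e| ^+ 5.
  by rewrite JE in hJ mx *; exact: taylor_quartic.
have [K H] := monomer_cdf_rate (ltn0Sn 2) q0 hJ um T.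
exists K => N N1; apply: kolmogorov_dist_le => z.
rewrite quartic_cdf_cumul // (_ : lambdac / 24 = quart (mc R)); last by rewrite lE; field.
exact: H.
Qed.
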